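(* Let $G=(V,E)$ be a connected, locally finite, transitive graph with base point $o\in V$ and graph distance $d$, let $\Gamma\subseteq\operatorname{Aut}(G)$ be a closed, transitive, unimodular subgroup of $\operatorname{Aut}(G)$, and suppose that $Q:V\times V\to[0,1]$ is a stochastic matrix that is symmetric and $\Gamma$-diagonally invariant in the sense that $Q(\gamma x,\gamma y)=Q(x,y)$ for every $x,y\in V$ and $\gamma\in\Gamma$. Let $X=(X_k)_{k\geq 0}$ be the random walk on $V$ with transition matrix $Q$. Let $\Phi$ be the isoperimetric profile of (the simple random walk on) $G$, let $\Lambda_Q$ be the spectral profile of $Q$, and let $$c=\frac{\min\{\#(\Gamma e\cap E^\rightarrow_o): e\in E^\rightarrow\}}{2\deg(o)}.$$ Then for every pair of integers $k,r\geq 1$, $$\mathbb{P}\left(d(X_0,X_k)\leq r\right)\leq 2\exp\left[-\frac{\log 2}{2}\max\left\{\ell\geq 0:\ \frac{\ell\log 2}{\Lambda_Q\left(2^{\ell+1}\Phi^{-1}(c/r)\right)}\leq k\right\}\right],$$ where the maximum is over non-negative integers $\ell$.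
   Context: $\operatorname{Aut}(G)$ is the automorphism group of $G$ with the topology of pointwise convergence (a locally compact group). A subgroup $\Gamma$ is transitive if it acts transitively on $V$. A closed subgroup $\Gamma$ is unimodular if its left Haar measure is also right-invariant; for transitive $\Gamma$ this is equivalent to $|\operatorname{Stab}_x y|=|\operatorname{Stab}_y x|$ for all $x,y\in V$, where $\operatorname{Stab}_x$ is the stabilizer of $x$ in $\Gamma$. Each edge is regarded as a pair of oriented edges in opposite directions. $E^\rightarrow$ is the set of oriented edges, $E^\rightarrow_o$ is the set of oriented edges emanating from $o$, and $\Gamma e$ is the orbit of $e$ under $\Gamma$. For a symmetric stochastic matrix $P$ on a countable set $V$, the isoperimetric profile is $$\Phi_P(n)=\inf\Big\{\frac{1}{|\Omega|}\sum_{x\in\Omega,\,y\in V\setminus\Omega}P(x,y):\ \emptyset\neq\Omega\subset V,\ |\Omega|\leq n\Big\},$$ and the spectral profile is $\Lambda_P(n)=\inf\{\lambda_P(\Omega):\emptyset\neq\Omega\subset V,\ |\Omega|\leq n\}$, where $$\lambda_P(\Omega)=\inf\{\langle (I-P)f,f\rangle:\ \operatorname{support}(f)\subset\Omega,\ \|f\|_2=1\}$$ with $\ell^2(V)$ taken with respect to counting measure. These are defined for real $n\geq 1$. The isoperimetric profile $\Phi$ of $G$ is that of its simple random walk transition matrix. For a decreasing function $f$, $f^{-1}(x)=\inf\{t: f(t)\leq x\}$. Conventions: if there is no $t$ with $\Phi(t)\leq c/r$, then $\Phi^{-1}(c/r)=\infty$ and the maximum is taken to be $0$ (so that the bound is trivial).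 The value $\ell=0$ always belongs to the set, and a ratio with $\ell\geq 1$ and zero denominator is $+\infty$. *)

(* Defs.v *)
From HB Require Import structures.
From mathcomp Require Import all_boot all_order all_algebra finmap.
From mathcomp Require Import all_classical all_reals all_analysis.

Set Implicit Arguments.
Unset Strict Implicit.
Unset Printing Implicit Defensive.

Import Order.TTheory GRing.Theory Num.Theory.
Import numFieldNormedType.Exports.

Local Open Scope classical_set_scope.
Local Open Scope ring_scope.

(* Graphs are simple: vertex type V, adjacency relation e, assumed symmetric
   and irreflexive where they are used. *)

Section Graph.
Context {V : choiceType}.
Implicit Types (e : rel V) (x y : V) (n : nat).

Definition neighbours e x : set V := [set y | e x y].

Definition locally_finite e := forall x, finite_set (neighbours e x).

Definition degree e x : nat := #|` fset_set (neighbours e x)|.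

Definition walk_of_length e x y n :=
  exists p : seq V, [/\ path e x p, last x p = y & size p = n].

Definition graph_connected e := forall x y, exists n, walk_of_length e x y n.

Let walkb e x y : pred nat := fun n => `[< walk_of_length e x y n >].

(* The default 0 is only reached when x and y are not connected. *)
Definition gdist e x y : nat :=
  if pselect (exists n, walkb e x y n) is left h then ex_minn h else 0%N.

Definition oriented_edges e : set (V * V) := [set a | e a.1 a.2].

Definition oriented_edges_from e x : set (V * V) :=
  [set a | e a.1 a.2 /\ a.1 = x].

End Graph.

Section Automorphisms.
Context {V : choiceType}.
Implicit Type e : rel V.

Definition is_automorphism e (f : V -> V) :=
  bijective f /\ forall x y, e (f x) (f y) = e x y.

Record aut e := Aut {
  aut_fun :> V -> V;
  aut_funP : `[< is_automorphism e aut_fun >] }.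

HB.instance Definition _ e := [isSub for @aut_fun e].
HB.instance Definition _ e := [Choice of aut e by <:].

Lemma autP e (g : aut e) : is_automorphism e g.
Proof. exact/asboolP/(valP g). Qed.

Lemma aut_eq e (g h : aut e) : (forall x, g x = h x) -> g = h.
Proof. by move=> gh; apply: val_inj; apply/funext. Qed.

Lemma aut_id_subproof e : `[< is_automorphism e id >].
Proof. by apply/asboolP; split => //; exists id. Qed.

Definition aut_id e : aut e := Aut (aut_id_subproof e).

Lemma aut_comp_subproof e (g h : aut e) : `[< is_automorphism e (g \o h) >].
Proof.
apply/asboolP; have [bg eg] := autP g; have [bh eh] := autP h.
by split=> [|x y]; [exact: bij_comp|rewrite /= eg eh].
Qed.

Definition aut_comp e (g h : aut e) : aut e := Aut (aut_comp_subproof g h).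

Lemma aut_inv_ex e (g : aut e) :
  {f : V -> V | [/\ cancel g f, cancel f g & is_automorphism e f]}.
Proof.
apply: cid; have [[f gK fK] eg] := autP g; exists f; split => //.
by split=> [|x y]; [exists g|rewrite -eg !fK].
Qed.

Lemma aut_inv_subproof e (g : aut e) :
  `[< is_automorphism e (sval (aut_inv_ex g)) >].
Proof. by apply/asboolP; case: (svalP (aut_inv_ex g)). Qed.

Definition aut_inv e (g : aut e) : aut e := Aut (aut_inv_subproof g).

Fact aut_compA e : associative (@aut_comp e).
Proof. by move=> f g h; apply: aut_eq. Qed.

Fact aut_comp1g e : left_id (@aut_id e) (@aut_comp e).
Proof. by move=> g; apply: aut_eq. Qed.

Fact aut_compg1 e : right_id (@aut_id e) (@aut_comp e).
Proof. by move=> g; apply: aut_eq. Qed.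

Fact aut_compVg e : left_inverse (@aut_id e) (@aut_inv e) (@aut_comp e).
Proof.
by move=> g; apply: aut_eq => x /=; case: (svalP (aut_inv_ex g)) => /= ->.
Qed.

Fact aut_compgV e : right_inverse (@aut_id e) (@aut_inv e) (@aut_comp e).
Proof.
by move=> g; apply: aut_eq => x /=; case: (svalP (aut_inv_ex g)) => /= _ ->.
Qed.

HB.instance Definition _ e := isGroup.Build (aut e)
  (@aut_compA e) (@aut_comp1g e) (@aut_compg1 e)
  (@aut_compVg e) (@aut_compgV e).

HB.instance Definition _ e := isPointed.Build (aut e) (aut_id e).

(* Topology of pointwise convergence, V being discrete. *)
Definition aut_ptws e (g : aut e) : {ptws V -> discrete_topology V} := g.

HB.instance Definition _ e :=
  Topological.copy (aut e) (initial_topology (@aut_ptws e)).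

Definition is_subgroup e (Gam : set (aut e)) :=
  Gam 1%g /\ forall g h, Gam g -> Gam h -> Gam (g * h^-1)%g.

Definition acts_transitively e (Gam : set (aut e)) :=
  forall x y : V, exists2 g, Gam g & g x = y.

Definition edge_orbit e (Gam : set (aut e)) (a : V * V) : set (V * V) :=
  [set (g a.1, g a.2) | g in Gam].

End Automorphisms.

Section Haar.
Context {R : realType} {V : choiceType} (e : rel V).

Definition borel_aut := g_sigma_algebraType (@open (aut e)).

Implicit Types (Gam : set (aut e)) (mu : {measure set borel_aut -> \bar R}).

(* For closed Gam, the Borel sets of Gam are the Borel sets of aut e contained
   in Gam, and every Borel measure on Gam extends to aut e by
   A |-> mu (A `&` Gam).  A measure on Gam is thus represented by a measure on
   aut e of which only the values on subsets of Gam are used. *)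
Definition borel_in Gam (A : set (aut e)) :=
  measurable (A : set borel_aut) /\ A `<=` Gam.

Definition left_invariant_on Gam mu :=
  forall g A, Gam g -> borel_in Gam A -> mu [set (g * a)%g | a in A] = mu A.

Definition right_invariant_on Gam mu :=
  forall g A, Gam g -> borel_in Gam A -> mu [set (a * g)%g | a in A] = mu A.

Definition radon_on Gam mu :=
  [/\ (forall K, compact K -> K `<=` Gam -> (mu K < +oo)%E),
      (forall A, borel_in Gam A ->
         mu A = ereal_inf [set mu (U `&` Gam) |
                            U in [set U | open U /\ A `<=` U]])
    & (forall U, open U ->
         mu (U `&` Gam) = ereal_sup [set mu K |
                            K in [set K | compact K /\ K `<=` U `&` Gam]])].

Definition left_haar_measure_on Gam mu :=
  [/\ mu Gam != 0%E, radon_on Gam mu & left_invariant_on Gam mu].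

End Haar.

(* The left Haar measure being unique up to scaling, "its left Haar measure is
   right-invariant" is expressed for one left Haar measure. *)
Definition unimodular (R : realType) (V : choiceType) (e : rel V)
    (Gam : set (aut e)) :=
  exists mu : {measure set (borel_aut e) -> \bar R},
    left_haar_measure_on Gam mu /\ right_invariant_on Gam mu.

Section Kernels.
Context {R : realType} {V : choiceType}.
Implicit Types (P : V -> V -> R) (f g : V -> R).

Definition stochastic P :=
  (forall x y, 0 <= P x y <= 1) /\
  (forall x, (\esum_(y in setT) (P x y)%:E)%E = 1%E).

Definition symmetric_kernel P := forall x y, P x y = P y x.

Definition diagonally_invariant (e : rel V) (Gam : set (aut e)) P :=
  forall (g : aut e) x y, Gam g -> P (g x) (g y) = P x y.

Definition srw (e : rel V) : V -> V -> R :=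
  fun x y => if e x y then (degree e x)%:R^-1 else 0.

Definition isoperimetric_ratio P (A : {fset V}) : \bar R :=
  ((\sum_(x <- A) \esum_(y in ~` [set` A]) (P x y)%:E)
     * (#|` A|%:R^-1)%:E)%E.

Definition isoperimetric_profile P (n : R) : \bar R :=
  ereal_inf [set isoperimetric_ratio P A |
              A in [set A : {fset V} | A != fset0 /\ #|` A|%:R <= n]].

(* The sums below range over the support of the summand and are only meant for
   finitely supported f and g, as in the spectral profile. *)
Definition kernel_op P f : V -> R := fun x => \sum_(y \in setT) P x y * f y.

Definition inner f g : R := \sum_(x \in setT) f x * g x.

Definition l2norm f : R := Num.sqrt (inner f f).

Definition lambda P (A : {fset V}) : \bar R :=
  ereal_inf [set (inner (fun x => f x - kernel_op P f x) f)%:E |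
              f in [set f | (forall x, x \notin A -> f x = 0)
                            /\ l2norm f = 1]].

Definition spectral_profile P (n : R) : \bar R :=
  ereal_inf [set lambda P A |
              A in [set A : {fset V} | A != fset0 /\ #|` A|%:R <= n]].

(* Generalised inverse of a decreasing function on [1, +oo[; it is +oo when no
   t satisfies f t <= x. *)
Definition profile_inverse (f : R -> \bar R) (x : R) : \bar R :=
  ereal_inf [set t%:E | t in [set t : R | 1 <= t /\ (f t <= x%:E)%E]].

(* The infimum of this set of natural numbers is its minimum. *)
Definition edge_constant (e : rel V) (Gam : set (aut e)) (o : V) : R :=
  inf [set #|` fset_set (edge_orbit Gam a `&` oriented_edges_from e o)|%:R |
        a in oriented_edges e]
  / (2 * (degree e o)%:R).

(* Extended-real division has x / 0 = +oo for 0 < x and 0 / 0 = 0.  When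
   profile_inverse is +oo the set is reduced to 0. *)
Definition admissible_exponents (e : rel V) (Gam : set (aut e)) (o : V) P
    (k r : nat) : set nat :=
  [set l | l = 0%N \/
     exists2 t : R,
       profile_inverse (isoperimetric_profile (srw e))
         (edge_constant Gam o / r%:R) = t%:E
     & ((l%:R * ln 2)%:E / spectral_profile P (2 ^+ l.+1 * t)
          <= k%:R%:E)%E].

(* Markov property with the conditional probabilities multiplied out; the law
   of X 0 is arbitrary. *)
Definition random_walk (d : measure_display) (Om : measurableType d)
    (Pr : probability Om R) (Q : V -> V -> R) (X : nat -> Om -> V) :=
  (forall n x, measurable (X n @^-1` [set x])) /\
  (forall n (s : nat -> V),
     Pr [set w | forall i, (i <= n.+1)%N -> X i w = s i] =
     (Pr [set w | forall i, (i <= n)%N -> X i w = s i]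
        * (Q (s n) (s n.+1))%:E)%E).

End Kernels.

Definition is_max (S : set nat) (m : nat) :=
  S m /\ forall l, S l -> (l <= m)%N.

(* Main.v *)
(** Let [q = Q^k] and [p = sum_{d(o,y) <= r} q(o,y)], so that the probability to
    be bounded is at most [p].  Choose a finite set [A] of cardinality at most
    [t = Phi^{-1}(c/r)] whose isoperimetric ratio is (almost) at most [c/r].
    Integrate over [g] in [Gam], with respect to Haar measure, the event that
    [g o] is in [A] and [g y] is not.  Along a geodesic from [o] to [y] one of the
    at most [r] edges leaves [A], and by invariance an edge leaves [A] with
    measure at most [|dA|] over the size of its orbit, relative to the stabilizer
    of [o].  Hence at most half of the mass is lost and
    [p |A| / 2 <= <Q^k 1_A, 1_A>].
    For finite truncations of [Q], let [f = 1_A / |A|] and cut the iterates of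
    [f], which have mass at most 1, at height [h = 2^-l / t].  What is above the
    cut lives on few points, where the spectral gap applies, and
    [<Q^k f, f> - 2 h] decays like [exp (- k Lambda)]. *)
Require Import Defs.
From HB Require Import structures.
From mathcomp Require Import all_boot all_order all_algebra finmap.
From mathcomp Require Import all_classical all_reals all_analysis.
From mathcomp Require Import ring lra.

Import Order.TTheory GRing.Theory Num.Theory.
Import numFieldNormedType.Exports.

Local Open Scope classical_set_scope.
Local Open Scope ring_scope.

Set Implicit Arguments.
Unset Strict Implicit.
Unset Printing Implicit Defensive.

(** * Truncations of the kernel *)

(** Multiplied by [expR x], the gap between the two sides is [f] below, which vanishes at 0 and has
    derivative y (e^y - e^-y) >= 0. It will turn the contraction factor (1 - lam) / (1 + lam) into
    an exponential. *)
Lemma expRN2_ge (R : realType) (x : R) : 0 <= x ->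
  1 - x <= expR (- (x * 2)) * (1 + x).
Proof.
rewrite le_eqVlt => /predU1P[<-|x0]; first by rewrite mul0r oppr0 expR0 mul1r; lra.
pose f (y : R) := (1 + y) * expR (- y) - (1 - y) * expR y.
pose f' (y : R) := y * (expR y - expR (- y)).
have df (y : R) : is_derive y (1 : R) f (f' y).
  rewrite /f /f'.
  apply: is_derive_eq.
  by rewrite /GRing.scale /=; ring.
have [] := @MVT R f f' _ _ x0 (fun y _ => df y).
  apply: derivable_within_continuous => y _; exact: (@ex_derive _ _ _ _ _ _ _ (df y)).
move=> y; rewrite in_itv /= => /andP[y0 _].
have -> : f 0 = 0 by rewrite /f oppr0 expR0; ring.
rewrite !subr0 => fx.
have : 0 <= f x.
  rewrite fx /f' mulr_ge0 ?(ltW x0)// mulr_ge0 ?(ltW y0)// subr_ge0 ler_expR; lra.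
rewrite /f subr_ge0 => h.
have -> : - (x * 2) = - x + - x by ring.
rewrite expRD -mulrA (mulrC (expR (- x)) (1 + x)).
rewrite -[leLHS](mulKf (lt0r_neq0 (expR_gt0 x))) -expRN ler_pM2l ?expR_gt0//.
by rewrite [leLHS]mulrC.
Qed.

Section TruncatedKernel.
Context {R : realType} {V : choiceType} (Q : V -> V -> R).
Context (Q_ge0 : forall x y, 0 <= Q x y) (Q_sym : symmetric_kernel Q).
Context (Q_sub : forall x (W : {fset V}), \sum_(y <- W) Q x y <= 1).
Implicit Types (W A : {fset V}) (f g h : V -> R).

Lemma sum_fset_le A W (F : V -> R) : (A `<=` W)%fset -> (forall x, 0 <= F x) ->
  \sum_(x <- A) F x <= \sum_(x <- W) F x.
Proof.
move=> AW F0; rewrite [leRHS](big_fsetID _ (mem A)) /=.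
have -> : [fset x in W | x \in A]%fset = A.
  apply/fsetP => x; rewrite !inE andbC; case: (boolP (x \in A)) => //= xA.
  exact: (fsubsetP AW).
by rewrite lerDl sumr_ge0.
Qed.

Definition trunc_op W f : V -> R := fun x => \sum_(y <- W) Q x y * f y.

Definition dot W f g : R := \sum_(x <- W) f x * g x.

Lemma trunc_op_ge0 W f : (forall x, 0 <= f x) -> forall x, 0 <= trunc_op W f x.
Proof. by move=> f0 x; apply: sumr_ge0 => y _; exact: mulr_ge0. Qed.

Lemma iter_trunc_op_ge0 W n f : (forall x, 0 <= f x) ->
  forall x, 0 <= iter n (trunc_op W) f x.
Proof. by move=> f0; elim: n => //= n IH; exact: trunc_op_ge0. Qed.

Lemma dot_trunc_op W f g :
  dot W (trunc_op W f) g = \sum_(x <- W) \sum_(y <- W) Q x y * (f y * g x).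
Proof.
by apply: eq_bigr => x _; rewrite mulr_suml; apply: eq_bigr => y _; rewrite mulrA.
Qed.

Lemma dotC W f g : dot W f g = dot W g f.
Proof. by apply: eq_bigr => x _; rewrite mulrC. Qed.

Lemma dot_trunc_opC W f g : dot W (trunc_op W f) g = dot W f (trunc_op W g).
Proof.
rewrite [RHS]dotC !dot_trunc_op exchange_big /=.
by apply: eq_bigr => x _; apply: eq_bigr => y _; rewrite Q_sym (mulrC (f _)).
Qed.

Lemma dot_iter_trunc_op W i j f g :
  dot W (iter (i + j) (trunc_op W) f) g =
  dot W (iter i (trunc_op W) f) (iter j (trunc_op W) g).
Proof.
elim: j i => [|j IH] i; first by rewrite addn0.
by rewrite addnS -addSn IH /= dot_trunc_opC.
Qed.

Lemma sum_trunc_op_le W f : (forall x, 0 <= f x) ->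
  \sum_(x <- W) trunc_op W f x <= \sum_(x <- W) f x.
Proof.
move=> f0; rewrite exchange_big /=; apply: ler_sum => y _.
rewrite -mulr_suml ler_piMl//; rewrite (eq_bigr (Q y)) => [|x _]; first exact: Q_sub.
exact: Q_sym.
Qed.

Lemma sum_iter_trunc_op_le W n f : (forall x, 0 <= f x) ->
  \sum_(x <- W) iter n (trunc_op W) f x <= \sum_(x <- W) f x.
Proof.
move=> f0; elim: n => //= n IH; apply: le_trans IH; apply: sum_trunc_op_le.
exact: iter_trunc_op_ge0.
Qed.

(** A Schur test: rows sum to at most 1 by hypothesis, columns by symmetry. *)
Lemma sum_double_le W (u v : V -> R) :
  (forall x, 0 <= u x) -> (forall x, 0 <= v x) ->
  \sum_(x <- W) \sum_(y <- W) Q x y * (u y + v x) <=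
  \sum_(x <- W) u x + \sum_(x <- W) v x.
Proof.
move=> u0 v0.
under eq_bigr do under eq_bigr do rewrite mulrDr.
under eq_bigr do rewrite big_split /=.
rewrite big_split /= lerD//; first exact: sum_trunc_op_le.
by apply: ler_sum => x _; rewrite -mulr_suml ler_piMl.
Qed.

Lemma dot_trunc_op_le W g : dot W (trunc_op W g) g <= dot W g g.
Proof.
rewrite dot_trunc_op.
have g2 x : 0 <= g x * g x / 2 by rewrite divr_ge0// -expr2 sqr_ge0.
have := @sum_double_le W _ _ g2 g2.
rewrite -big_split/= [X in _ <= X -> _](eq_bigr (fun x => g x * g x)); last first.
  by move=> x _; field.
apply: le_trans; apply: ler_sum => x _; apply: ler_sum => y _.
apply: ler_wpM2l => //; have := sqr_ge0 (g x - g y); nra.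
Qed.

(** The bound lam <= Lambda_Q(N), free of infima and of normalisation. *)
Definition spectral_gap (N lam : R) := forall A g, #|` A|%:R <= N ->
  dot A (trunc_op A g) g <= (1 - lam) * dot A g g.

Let excess c f : V -> R := fun x => Num.max (f x - c) 0.

(** The last inequality says (a' - b')^2 <= (a - b)^2: cutting at height c is 1-Lipschitz. The third
    one makes the loss of squared norm at most 2 c times the mass. *)
Lemma excess_facts c (a b : R) : 0 <= c -> 0 <= a -> 0 <= b ->
  let a' := Num.max (a - c) 0 in let b' := Num.max (b - c) 0 in
  [/\ 0 <= a', a' * a' <= a * a, a * a - 2 * c * a <= a' * a'
    & a * b - a' * b' <= (a * a - a' * a') / 2 + (b * b - b' * b') / 2].
Proof.
move=> c0 a0 b0 a' b'.
have [[ha ->]|[ha ->]] : (a - c <= 0 /\ a' = 0) \/ (0 <= a - c /\ a' = a - c).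
- by rewrite /a'; case: (leP (a - c) 0) => h; [left|right; split => //; exact: ltW].
- have [[hb ->]|[hb ->]] : (b - c <= 0 /\ b' = 0) \/ (0 <= b - c /\ b' = b - c).
  + by rewrite /b'; case: (leP (b - c) 0) => h; [left|right; split => //; exact: ltW].
  + have := sqr_ge0 (a - b); split => //; nra.
  + split => //; first nra; first nra.
    have := sqr_ge0 (a - b); nra.
- have [[hb ->]|[hb ->]] : (b - c <= 0 /\ b' = 0) \/ (0 <= b - c /\ b' = b - c).
  + by rewrite /b'; case: (leP (b - c) 0) => h; [left|right; split => //; exact: ltW].
  + have := sqr_ge0 (a - b); split => //; nra.
  + have := sqr_ge0 (a - b); split => //; nra.
Qed.

(* Polarization: the absolute value turns the lower bound needed for f - h
   into the upper bound given by the spectral gap. *)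
Lemma dot_trunc_op_polar A (N lam : R) f h : spectral_gap N lam ->
  #|` A|%:R <= N ->
  dot A (trunc_op A f) h <= (1 - lam) / 2 * (dot A f f + dot A h h).
Proof.
move=> gap AN.
have := gap A (fun x => f x + h x) AN.
have := gap A (fun x => `|f x - h x|) AN.
have -> : dot A (fun x => `|f x - h x|) (fun x => `|f x - h x|)
  = dot A f f + dot A h h - 2 * dot A f h.
  rewrite /dot mulr_sumr -big_split -sumrB; apply: eq_bigr => x _ /=.
  by rewrite -normrM ger0_norm; [ring|rewrite -expr2 sqr_ge0].
have -> : dot A (fun x => f x + h x) (fun x => f x + h x)
  = dot A f f + dot A h h + 2 * dot A f h.
  by rewrite /dot mulr_sumr -!big_split; apply: eq_bigr => x _ /=; ring.
have -> : dot A (trunc_op A (fun x => f x + h x)) (fun x => f x + h x)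
  = dot A (trunc_op A f) f + dot A (trunc_op A h) h + 2 * dot A (trunc_op A f) h.
  have -> : 2 * dot A (trunc_op A f) h
    = dot A (trunc_op A f) h + dot A (trunc_op A h) f.
    by rewrite [X in _ + X]dot_trunc_opC [X in _ + X]dotC; ring.
  rewrite !dot_trunc_op -!big_split; apply: eq_bigr => x _ /=.
  by rewrite -!big_split; apply: eq_bigr => y _ /=; ring.
have : - (dot A (trunc_op A f) f + dot A (trunc_op A h) h
          - 2 * dot A (trunc_op A f) h)
  <= dot A (trunc_op A (fun x => `|f x - h x|)) (fun x => `|f x - h x|).
  have -> : 2 * dot A (trunc_op A f) h
    = dot A (trunc_op A f) h + dot A (trunc_op A h) f.
    by rewrite [X in _ + X]dot_trunc_opC [X in _ + X]dotC; ring.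
  rewrite !dot_trunc_op -!big_split -sumrB -sumrN; apply: ler_sum => x _ /=.
  rewrite -!big_split -sumrB -sumrN; apply: ler_sum => y _ /=.
  rewrite -normrM.
  have -> : - (Q x y * (f y * f x) + Q x y * (h y * h x) -
    (Q x y * (f y * h x) + Q x y * (h y * f x))) =
    Q x y * - ((f y - h y) * (f x - h x)) by ring.
  by apply: ler_wpM2l => //; rewrite -normrN ler_norm.
set S := dot A f f + dot A h h; set T := dot A f h.
set X := dot A (trunc_op A f) h; set Y := _ + dot A (trunc_op A h) h.
set Z := dot A (trunc_op _ _) _; nra.
Qed.

Lemma dot_trunc_op_gap W (N lam c : R) f h : spectral_gap N lam ->
  0 <= lam <= 1 -> 0 < c -> 2 / c <= N ->
  (forall x, 0 <= f x) -> (forall x, 0 <= h x) ->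
  \sum_(x <- W) f x <= 1 -> \sum_(x <- W) h x <= 1 ->
  dot W (trunc_op W f) h - 2 * c
    <= (1 - lam) / 2 * (dot W f f + dot W h h - 4 * c).
Proof.
move=> gap /andP[l0 l1] c0 cN f0 h0 f1 h1.
have pf x y := excess_facts (ltW c0) (f0 x) (h0 y).
have ph x y := excess_facts (ltW c0) (h0 x) (f0 y).
have contr : dot W (trunc_op W f) h - dot W (trunc_op W (excess c f)) (excess c h)
  <= (dot W f f - dot W (excess c f) (excess c f)) / 2
     + (dot W h h - dot W (excess c h) (excess c h)) / 2.
  rewrite !dot_trunc_op -!sumrB !mulr_suml.
  apply: le_trans (@sum_double_le W
    (fun x => (f x * f x - excess c f x * excess c f x) / 2)
    (fun x => (h x * h x - excess c h x * excess c h x) / 2) _ _).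
  - apply: ler_sum => x _; rewrite -sumrB; apply: ler_sum => y _.
    by rewrite -mulrBr; apply: ler_wpM2l => //; case: (pf y x).
  - by move=> x; rewrite divr_ge0// subr_ge0; case: (pf x x).
  - by move=> x; rewrite divr_ge0// subr_ge0; case: (ph x x).
have l2f : dot W f f - 2 * c <= dot W (excess c f) (excess c f).
  have : dot W f f - 2 * c * \sum_(x <- W) f x <= dot W (excess c f) (excess c f).
    rewrite mulr_sumr -sumrB; apply: ler_sum => x _.
    by case: (pf x x).
  by nra.
have l2h : dot W h h - 2 * c <= dot W (excess c h) (excess c h).
  have : dot W h h - 2 * c * \sum_(x <- W) h x <= dot W (excess c h) (excess c h).
    rewrite mulr_sumr -sumrB; apply: ler_sum => x _.
    by case: (ph x x).
  by nra.
(* Outside [A] both cut functions vanish on [W], so their pairings over [W] and over [A] agree. *)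
pose A : {fset V} := [fset x in W | (c < f x) || (c < h x)]%fset.
have AW : (A `<=` W)%fset by apply/fsubsetP => x; rewrite !inE => /andP[].
have fA x : x \in W -> x \notin A -> (excess c f x = 0) * (excess c h x = 0).
  rewrite !inE => -> /=; rewrite negb_or -!leNgt => /andP[fx hx].
  by split; apply/max_idPr; rewrite subr_le0.
(* Markov's inequality: [f + h] is at least [c] on [A] and has mass at most 2. *)
have Acard : #|` A|%:R <= N.
  apply: le_trans cN; rewrite ler_pdivlMr//.
  have -> : #|` A|%:R * c = \sum_(x <- A) c.
    by rewrite big_const_seq count_predT iter_addr addr0 mulr_natl.
  have -> : (2 : R) = 1 + 1 by ring.
  apply: le_trans (lerD f1 h1); rewrite -big_split /=.
  apply: (@le_trans _ _ (\sum_(x <- A) (f x + h x))).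
    rewrite big_seq [leRHS]big_seq; apply: ler_sum => x; rewrite !inE => /andP[_].
    by have := f0 x; have := h0 x => ? ? /orP[]; lra.
  by apply: sum_fset_le => // x; rewrite addr_ge0.
have polar := @dot_trunc_op_polar A N lam (excess c f) (excess c h) gap Acard.
have dotAW u v : (forall x, x \in W -> x \notin A -> u x * v x = 0) ->
  dot A u v = dot W u v by move=> uv; exact: big_fset_incl.
have dfA : dot A (excess c f) (excess c f) = dot W (excess c f) (excess c f).
  by apply: dotAW => x xW xA; rewrite fA// mul0r.
have dhA : dot A (excess c h) (excess c h) = dot W (excess c h) (excess c h).
  by apply: dotAW => x xW xA; rewrite (fA x xW xA).2 mul0r.
have dfhA : dot A (trunc_op A (excess c f)) (excess c h)
  = dot W (trunc_op W (excess c f)) (excess c h).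
  rewrite -dotAW; last by move=> x xW xA; rewrite (fA x xW xA).2 mulr0.
  apply: eq_bigr => x _; congr (_ * _).
  by apply: big_fset_incl => // y yW yA; rewrite fA// mulr0.
rewrite dfA dhA dfhA in polar.
by nra.
Qed.

(** By self-adjointness the pairing at time 2 j is the squared norm of [u j]; let E_j be that norm
    minus 2 c. The gap for [u j] and [u j.+1] reads E_{j+1} <= (1 - lam) (E_j + E_{j+1}) / 2, whence
    E_{j+1} <= (1 - lam) / (1 + lam) E_j <= exp (- 2 lam) E_j. The assumption 2 c <= [dot W f f]
    gives E_0 >= 0, so that the factors can be compared. *)
Lemma dot_iter_trunc_op_decay W (N lam c : R) f : spectral_gap N lam ->
  0 <= lam <= 1 -> 0 < c -> 2 / c <= N ->
  (forall x, 0 <= f x) -> \sum_(x <- W) f x <= 1 -> 2 * c <= dot W f f ->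
  forall k, dot W (iter k (trunc_op W) f) f - 2 * c
    <= expR (- (lam * k%:R)) * (dot W f f - 2 * c).
Proof.
move=> gap l01 c0 cN f0 f1 cf.
pose u j := iter j (trunc_op W) f.
have u0 j x : 0 <= u j x by exact: iter_trunc_op_ge0.
have u1 j : \sum_(x <- W) u j x <= 1.
  by apply: le_trans f1; exact: sum_iter_trunc_op_le.
have key i j := dot_trunc_op_gap gap l01 c0 cN (u0 i) (u0 j) (u1 i) (u1 j).
have [l0 l1] := andP l01.
have even j : dot W (u j) (u j) - 2 * c
    <= expR (- (lam * (j + j)%:R)) * (dot W f f - 2 * c).
  elim: j => [|j IH]; first by rewrite addn0 mulr0 oppr0 expR0 mul1r.
  have /= := key j j.+1.
  have -> : dot W (trunc_op W (u j)) (u j.+1) = dot W (u j.+1) (u j.+1) by [].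
  move=> kj.
  have step : (1 + lam) * (dot W (u j.+1) (u j.+1) - 2 * c)
    <= (1 - lam) * (dot W (u j) (u j) - 2 * c) by nra.
  rewrite -(ler_pM2l (_ : 0 < 1 + lam)); last lra.
  apply: le_trans step _.
  have -> : - (lam * (j.+1 + j.+1)%:R) = - (lam * 2) + - (lam * (j + j)%:R).
    by rewrite addSn addnS -2![in LHS]natr1; ring.
  rewrite expRD; apply: (le_trans (ler_wpM2l _ IH)); first lra.
  rewrite !mulrA ler_wpM2r ?subr_ge0// ler_wpM2r ?expR_ge0// [leRHS]mulrC.
  exact: expRN2_ge.
move=> k; have [j [b ->]] : exists j (b : bool), k = (j + b + j)%N.
  by exists k./2, (odd k); rewrite addnAC addnn addnC odd_double_half.
(* An odd time costs one more application of the gap, to the pair [u j], [u j], with factor 1 - lam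
   <= exp (- lam). *)
rewrite dot_iter_trunc_op; case: b; last by rewrite addn0; exact: even.
have -> : iter (j + true) (trunc_op W) f = trunc_op W (u j) by rewrite addn1.
have /= kj := key j j.
have k' : dot W (trunc_op W (u j)) (u j) - 2 * c
  <= (1 - lam) * (dot W (u j) (u j) - 2 * c) by nra.
apply: (le_trans k').
have -> : - (lam * (j + true + j)%:R) = - lam + - (lam * (j + j)%:R).
  by rewrite addn1 addSn -natr1; ring.
rewrite expRD -mulrA; apply: (le_trans (ler_wpM2l _ (even j))); first lra.
rewrite ler_wpM2r ?mulr_ge0 ?expR_ge0 ?subr_ge0//.
exact: expR_ge1Dx.
Qed.

End TruncatedKernel.

(** * Powers of the kernel and returns to a finite set *)

Section IteratedKernel.
Context {R : realType} {V : choiceType} (Q : V -> V -> R).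
Context (Q_ge0 : forall x y, 0 <= Q x y) (Q_sym : symmetric_kernel Q).
Context (Q_sub : forall x (W : {fset V}), \sum_(y <- W) Q x y <= 1).
Implicit Types (W A : {fset V}) (f g h : V -> R) (n : nat).

Lemma trunc_opE W f x : trunc_op Q W f x = \sum_(y <- W) Q x y * f y.
Proof. by []. Qed.

Lemma iter_trunc_op_sum W A (F : V -> V -> R) n x :
  iter n (trunc_op Q W) (fun z => \sum_(y <- A) F y z) x
  = \sum_(y <- A) iter n (trunc_op Q W) (F y) x.
Proof.
elim: n x => //= n IH x;
transitivity (\sum_(z <- W) \sum_(y <- A) Q x z * iter n (trunc_op Q W) (F y) z).
  by apply: eq_bigr => z _; rewrite IH mulr_sumr.
by rewrite exchange_big.
Qed.

Lemma iter_trunc_opZ W (a : R) f n x :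
  iter n (trunc_op Q W) (fun z => a * f z) x = a * iter n (trunc_op Q W) f x.
Proof.
elim: n x => //= n IH x; rewrite !trunc_opE mulr_sumr.
by apply: eq_bigr => y _; rewrite IH mulrCA.
Qed.

Lemma iter_trunc_op_le W A f n x : (A `<=` W)%fset -> (forall x, 0 <= f x) ->
  iter n (trunc_op Q A) f x <= iter n (trunc_op Q W) f x.
Proof.
move=> AW f0; elim: n x => //= n IH x.
apply: le_trans (sum_fset_le AW _) => [|y].
  by apply: ler_sum => y _; exact: ler_wpM2l.
by rewrite mulr_ge0// iter_trunc_op_ge0.
Qed.

Lemma iter_trunc_op_le1 W f n x : (forall x, f x <= 1) ->
  iter n (trunc_op Q W) f x <= 1.
Proof.
move=> f1; elim: n x => //= n IH x; apply: le_trans (Q_sub x W).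
by apply: ler_sum => y _; rewrite -[leRHS]mulr1 ler_wpM2l.
Qed.

Definition delta (y : V) : V -> R := fun z => (z == y)%:R.

Lemma delta_ge0 y z : 0 <= delta y z. Proof. exact: ler0n. Qed.

Lemma delta_le1 y z : delta y z <= 1. Proof. by rewrite /delta lern1 leq_b1. Qed.

Lemma sum_delta A x : \sum_(y <- A) delta y x = (x \in A)%:R.
Proof.
case: (boolP (x \in A)) => xA.
  rewrite (big_fsetD1 x)//= /delta eqxx big_seq big1 ?addr0// => y.
  by rewrite !inE eq_sym => /andP[/negPf ->].
by rewrite big_seq big1// /delta => y yA; case: eqP => // xy; rewrite xy yA in xA.
Qed.

(* The n-th power of Q, as the limit of the powers of its finite truncations. *)
Definition kernel_pow n x y : R :=
  sup [set iter n (trunc_op Q W) (delta y) x | W in [set: {fset V}]].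

Lemma has_sup_kernel_pow n x y :
  has_sup [set iter n (trunc_op Q W) (delta y) x | W in [set: {fset V}]].
Proof.
split; first by exists (iter n (trunc_op Q fset0) (delta y) x); exists fset0.
by exists 1 => _ [W _ <-]; apply: iter_trunc_op_le1 => z; exact: delta_le1.
Qed.

Lemma trunc_le_kernel_pow W n x y :
  iter n (trunc_op Q W) (delta y) x <= kernel_pow n x y.
Proof. by apply: ub_le_sup; [case: (has_sup_kernel_pow n x y)|exists W]. Qed.

Lemma kernel_pow_ge0 n x y : 0 <= kernel_pow n x y.
Proof.
apply: le_trans (trunc_le_kernel_pow fset0 n x y).
by apply: iter_trunc_op_ge0 => // z; exact: delta_ge0.
Qed.

(** A finite sum of suprema is the supremum of the sums because truncations increase with [W]: the
    induction absorbs the set chosen for each term into the lower bound [W0]. *)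
Lemma sum_kernel_pow_le (s : seq (V * V)) n (W0 : {fset V}) (M : R) :
  (forall W, (W0 `<=` W)%fset ->
    \sum_(z <- s) iter n (trunc_op Q W) (delta z.2) z.1 <= M) ->
  \sum_(z <- s) kernel_pow n z.1 z.2 <= M.
Proof.
elim: s W0 M => [|z s IH] W0 M H.
  by rewrite big_nil; have := H W0 (fsubset_refl _); rewrite big_nil.
rewrite big_cons -lerBrDr; apply: ge_sup => [|_ [W1 _ <-]].
  by case: (has_sup_kernel_pow n z.1 z.2).
rewrite lerBrDr -lerBrDl; apply: (IH (W0 `|` W1)%fset) => W /fsubUsetP[W0W W1W].
rewrite lerBrDl; have := H _ W0W; rewrite big_cons; apply: le_trans.
by rewrite lerD2r iter_trunc_op_le// => ?; exact: delta_ge0.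
Qed.

(** The map [g] carries the truncation to [W] onto the truncation to its image, which competes in
    the supremum on the right. *)
Lemma kernel_pow_inv_le (g : V -> V) n x y : injective g ->
  (forall x y, Q (g x) (g y) = Q x y) ->
  kernel_pow n x y <= kernel_pow n (g x) (g y).
Proof.
move=> gI gQ; apply: ge_sup => [|_ [W _ <-]].
  by case: (has_sup_kernel_pow n x y).
apply: le_trans (trunc_le_kernel_pow [fset g z | z in W]%fset n (g x) (g y)).
rewrite le_eqVlt; apply/orP; left; apply/eqP.
elim: n x => [|n IH] x /=; first by rewrite /delta inj_eq.
rewrite !trunc_opE big_imfset /=; last by move=> ? ? _ _; exact: gI.
by apply: eq_bigr => z _; rewrite gQ IH.
Qed.

(** The decay estimate for the normalised indicator of [A], cut at height [c] = 2^-L / t, for which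
    2 / c is exactly the size 2^(L+1) t allowed by the gap. The assumption relating [L] and [k]
    makes the decay factor at most 2^-L. *)
Lemma sum_trunc_kernel_le W A (L : nat) (lam t : R) k :
  spectral_gap Q (2 ^+ L.+1 * t) lam -> 0 <= lam <= 1 ->
  (L%:R * ln 2 <= k%:R * lam) -> A != fset0 -> #|` A|%:R <= t ->
  (0 < L)%N -> (A `<=` W)%fset ->
  \sum_(x <- A) \sum_(y <- A) iter k (trunc_op Q W) (delta y) x
    <= #|` A|%:R * (2 ^- L * (3 - 2 * 2 ^- L)).
Proof.
move=> gap l01 Lk A0 At L0 AW.
set a : R := #|` A|%:R.
have a0 : 0 < a by rewrite ltr0n cardfs_gt0.
have t0 : 0 < t by exact: lt_le_trans At.
set w : R := 2 ^- L.
have w0 : 0 < w by rewrite invr_gt0 exprn_gt0.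
have w1 : w <= 2^-1.
  by rewrite lef_pV2 ?posrE ?exprn_gt0// -[leLHS]expr1 ler_eXn2l// ltr1n.
pose f x := a^-1 * (x \in A)%:R.
pose c := w / t.
have f0 x : 0 <= f x by rewrite mulr_ge0 ?invr_ge0 ?(ltW a0).
have sumA (F : V -> R) : \sum_(x <- W) F x * (x \in A)%:R = \sum_(x <- A) F x.
  rewrite -(@big_fset_incl _ _ _ _ A W _ AW); last first.
    by move=> x _ /negPf ->; rewrite mulr0.
  by rewrite big_seq [RHS]big_seq; apply: eq_bigr => x ->; rewrite mulr1.
have cardA : \sum_(x <- A) 1 = a.
  by rewrite big_const_seq count_predT iter_addr addr0.
have f1 : \sum_(x <- W) f x = 1.
  have <- : a^-1 * \sum_(x <- A) 1 = 1 by rewrite cardA mulVf// lt0r_neq0.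
  by rewrite (sumA (fun=> a^-1)) mulr_sumr; apply: eq_bigr => x _; rewrite mulr1.
have dotf u : dot W u f = a^-1 * \sum_(x <- A) u x.
  by rewrite -sumA mulr_sumr; apply: eq_bigr => x _; rewrite mulrCA.
have ff : dot W f f = a^-1.
  rewrite dotf -[RHS]mulr1; congr (_ * _).
  rewrite -f1 -sumA; apply: eq_bigr => x _.
  by rewrite /f -mulrA -natrM mulnb andbb.
have c0 : 0 < c by rewrite divr_gt0.
have cN : 2 / c <= 2 ^+ L.+1 * t.
  by rewrite /c invf_div /w invrK exprS [t * _]mulrC mulrA.
(* Since [L] is positive, 2 w <= 1, so 2 c <= 1 / t <= 1 / a, the squared norm of [f]. *)
have cf : 2 * c <= dot W f f.
  rewrite ff /c mulrA ler_pdivrMr//; apply: (@le_trans _ _ 1); first lra.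
  by rewrite ler_pdivlMl// mulr1.
have := dot_iter_trunc_op_decay Q_ge0 Q_sym Q_sub gap l01 c0 cN f0 _ cf k.
rewrite f1 => /(_ (lexx _)).
have -> : dot W (iter k (trunc_op Q W) f) f =
  a^-1 * (a^-1 * \sum_(x <- A) \sum_(y <- A) iter k (trunc_op Q W) (delta y) x).
  rewrite dotf; congr (_ * _); rewrite mulr_sumr; apply: eq_bigr => x _.
  rewrite -iter_trunc_op_sum -iter_trunc_opZ; congr (iter _ _ _ x).
  by apply/funext => z; rewrite sum_delta.
have E : expR (- (lam * k%:R)) <= w.
  rewrite /w -(lnK (_ : (2 : R) \is Num.pos)) ?posrE// -expRM_natr -expRN.
  by rewrite ler_expR lerN2 mulrC (mulrC lam).
rewrite ff; set S := \sum_(x <- A) _.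
rewrite ff in cf.
have := ler_wpM2r (_ : 0 <= a^-1 - 2 * c) E; rewrite subr_ge0 => /(_ cf) E' H.
have H1 : a^-1 * (a^-1 * S) <= w * (a^-1 - 2 * c) + 2 * c by lra.
rewrite mulrA -invfM mulrC ler_pdivrMr ?mulr_gt0// in H1.
apply: (le_trans H1).
have -> : (w * (a^-1 - 2 * c) + 2 * c) * (a * a) =
  a * (w * (1 - 2 * (c * a)) + 2 * (c * a)).
  by field; exact: lt0r_neq0.
rewrite ler_pM2l//.
(* The bound increases with c a, as w <= 1; the value c a = w gives w (1 - 2 w) + 2 w = w (3 - 2
   w). *)
have ca : c * a <= w by rewrite /c -mulrA ger_pMr// mulrC ler_pdivrMr// mul1r.
nra.
Qed.

End IteratedKernel.

(** * Compactness of vertex stabilizers *)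

Section Balls.
Context {V : choiceType} (e : rel V).
Context (e_fin : locally_finite e).
Implicit Types (x y : V) (n : nat).

Lemma finite_sphere x n : finite_set [set y | walk_of_length e x y n].
Proof.
elim: n => [|n IH].
  apply: (sub_finite_set _ (finite_set1 x)) => y [p [_ <- /size0nil ->]] //.
apply: (sub_finite_set _ (bigcup_finite IH (fun z _ => e_fin z))).
move=> y [p]; case/lastP: p => [[]//|p z].
rewrite rcons_path last_rcons size_rcons => -[/andP[pp pz] <- [sp]].
by exists (last x p) => //; exists p.
Qed.

Context (e_conn : graph_connected e).

Lemma gdistP x y : walk_of_length e x y (gdist e x y).
Proof.
rewrite /gdist; case: pselect => [h|].
  by case: ex_minnP => m /asboolP.
by have [n xyn] := e_conn x y; case; exists n; apply/asboolP.
Qed.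

Lemma gdist_le x y n : walk_of_length e x y n -> (gdist e x y <= n)%N.
Proof.
move=> xyn; rewrite /gdist; case: pselect => [h|//].
by case: ex_minnP => m _; apply; apply/asboolP.
Qed.

Lemma finite_ball x n : finite_set [set y | (gdist e x y <= n)%N].
Proof.
apply: (sub_finite_set _ (bigcup_finite (finite_II n.+1)
  (fun m _ => finite_sphere x m))) => y /= xy.
by exists (gdist e x y) => //; exact: gdistP.
Qed.

Definition gball x n : {fset V} := fset_set [set y | (gdist e x y <= n)%N].

Lemma in_gball x n y : (y \in gball x n) = (gdist e x y <= n)%N.
Proof.
rewrite in_fset_set; last exact: finite_ball.
by apply/idP/idP => [/set_mem|/mem_set].
Qed.

Lemma aut_walk (g : aut e) x y n :
  walk_of_length e x y n -> walk_of_length e (g x) (g y) n.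
Proof.
move=> [p [pp <- <-]]; exists (map g p); split; last by rewrite size_map.
  rewrite path_map; apply: sub_path pp => a b; have [_ ge] := autP g.
  by rewrite /= ge.
by rewrite last_map.
Qed.

Lemma gdist_aut (g : aut e) x y : (gdist e (g x) (g y) <= gdist e x y)%N.
Proof. exact/gdist_le/aut_walk/gdistP. Qed.

End Balls.

Lemma aut_inj (V : choiceType) (e : rel V) (g : aut e) : injective g.
Proof. by have [/bij_inj] := autP g. Qed.

Section StabilizerCompact.
Context {V : choiceType} (e : rel V).
Context (e_fin : locally_finite e) (e_conn : graph_connected e).

(** Evaluation at a vertex is continuous into discrete [V]. Every event about the image of a vertex
    is therefore Borel. *)
Lemma open_aut_ev (x : V) (D : set V) : open [set g : aut e | D (g x)].
Proof.
exists (@proj V (fun=> discrete_topology V) x @^-1` D) => //.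
by apply: open_comp => [f _|]; [exact: proj_continuous|exact: discrete_open].
Qed.

(** Otherwise the ultrafilter contains the complement of every fibre, hence the intersection of the
    finitely many over [D], which misses the preimage of [D]. *)
Lemma ultra_finite_ev (T : Type) (F : set_system T) (f : T -> V) (D : set V) :
  UltraFilter F -> finite_set D -> F (f @^-1` D) ->
  exists u, F (f @^-1` [set u]).
Proof.
move=> UF Dfin FD; apply: contrapT => /forallNP H.
have PF : ProperFilter F by exact: ultra_proper.
have FH u : F (~` (f @^-1` [set u])).
  by have [/H//|//] := in_ultra_setVsetC (f @^-1` [set u]) UF.
have FI : F (\bigcap_(u in [set` fset_set D]) ~` (f @^-1` [set u])).
  by apply: filter_bigI => u _; exact: FH.
apply: (@filter_not_empty _ F PF).
apply: filterS (filterI FD FI) => t [Dt] /(_ (f t)); apply => //=.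
by rewrite in_fset_set// mem_set.
Qed.

(* The values at each point of the elements of the stabilizer and of their
   inverses range over a finite set, so they are constant along an
   ultrafilter. *)
Lemma compact_stabilizer (o : V) : compact [set g : aut e | g o = o].
Proof.
rewrite compact_ultra => F UF Fo.
have Fwalk (x : V) : exists n, forall g : aut e, g o = o ->
    walk_of_length e o (g x) n /\ walk_of_length e o ((g^-1)%g x) n.
  have [n ox] := e_conn o x; exists n => g go; split.
    by rewrite -{1}go; exact: aut_walk.
  have go' : (g^-1)%g o = o by rewrite -{1}go; case: (svalP (aut_inv_ex g)) => /= ->.
  by rewrite -{1}go'; exact: aut_walk.
have PF : ProperFilter F by exact: ultra_proper.
have Fex x : exists u, F [set g : aut e | g x = u].
  have [n Hn] := Fwalk x.
  apply: (@ultra_finite_ev _ F (fun g : aut e => g x) _ UF (finite_sphere e_fin o n)).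
  by apply: filterS Fo => g /Hn[].
have [f Ff] := choice Fex.
have Ff2 x y : exists2 g : aut e, g x = f x & g y = f y.
  by have [g [gx gy]] := filter_ex (filterI (Ff x) (Ff y)); exists g.
have f_inj : injective f.
  by move=> x y fxy; have [g gx gy] := Ff2 x y; apply: (@aut_inj _ _ g); rewrite gx gy.
have f_surj y : exists x, f x = y.
  have [n Hn] := Fwalk y.
  have [x Fx] : exists x, F [set g : aut e | (g^-1)%g y = x].
    apply: (@ultra_finite_ev _ F (fun g : aut e => (g^-1)%g y) _ UF
      (finite_sphere e_fin o n)).
    by apply: filterS Fo => g /Hn[].
  exists x; have [g [gx /= <-]] := filter_ex (filterI Fx (Ff x)).
  by rewrite -gx; case: (svalP (aut_inv_ex g)) => /= _ ->.
have f_aut : is_automorphism e f.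
  split=> [|x y]; last first.
    by have [g <- <-] := Ff2 x y; have [_ ge] := autP g; exact: ge.
  have [h hK] := choice f_surj.
  by exists h => // x; apply: f_inj; rewrite hK.
pose phi : aut e := Aut (introT (asboolP _) f_aut).
exists phi; split; first by have [g [/= <- ]] := filter_ex (filterI (Ff o) Fo).
move=> U; rewrite nbhsE => -[B [[C openC <-] Cphi] BU].
apply: filterS BU _.
have : nbhs (aut_ptws phi) C by exact: open_nbhs_nbhs.
have : (@aut_ptws _ e @ F) --> (aut_ptws phi).
  apply/(@pointwise_cvgP (discrete_topology V) (discrete_topology V)) => x A.
  move=> /nbhs_singleton Ax; suff : F [set g : aut e | A (g x)] by [].
  by apply: filterS (Ff x) => g /= ->.
by apply.
Qed.

End StabilizerCompact.

(** * Mass transport *)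

Lemma measure_fibers (d : measure_display) (T : measurableType d) (R : realType)
    (mu : {measure set T -> \bar R}) (I : choiceType) (D : {fset I})
    (k : T -> I) (S : set T) :
  (forall i, measurable (S `&` k @^-1` [set i])) ->
  (forall x, S x -> k x \in D) ->
  mu S = (\sum_(i <- D) mu (S `&` k @^-1` [set i]))%E.
Proof.
move=> mS SD; rewrite -measure_fbigsetU; last first.
- by move=> i j _ _ [x [[_ /= <-] [_ /= <-]]].
- by move=> i _; exact: mS.
congr (mu _); rewrite -bigcup_fset; apply/seteqP; split => x.
  by move=> Sx; exists (k x); [exact: SD|].
by move=> [i _ []].
Qed.

Section HaarCounting.
Context {R : realType} {V : choiceType} (e : rel V).
Context (e_fin : locally_finite e) (e_conn : graph_connected e).
Context (Gam : set (aut e)) (Gam_group : is_subgroup Gam).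
Context (Gam_closed : closed Gam) (Gam_trans : acts_transitively Gam).
Context (mu : {measure set (borel_aut e) -> \bar R}).
Context (mu_haar : left_haar_measure_on Gam mu).
Context (mu_right : right_invariant_on Gam mu).
Implicit Types (g h : aut e) (x y z u v w o : V) (A B : {fset V}).

Lemma autME g h x : (g * h)%g x = g (h x).
Proof. by []. Qed.

Lemma aut_invK g : cancel g (g^-1)%g.
Proof. by move=> x; case: (svalP (aut_inv_ex g)) => /= ->. Qed.

Lemma aut_invVK g : cancel (g^-1)%g g.
Proof. by move=> x; case: (svalP (aut_inv_ex g)) => /= _ ->. Qed.

Lemma GamV g : Gam g -> Gam (g^-1)%g.
Proof. by move=> Gg; case: Gam_group => G1 /(_ 1%g g G1 Gg); rewrite mul1g. Qed.

Lemma GamM g h : Gam g -> Gam h -> Gam (g * h)%g.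
Proof. by move=> Gg /GamV Gh; case: Gam_group => _ /(_ g _ Gg Gh); rewrite invgK. Qed.

Lemma measurable_open (U : set (aut e)) :
  open U -> measurable (U : set (borel_aut e)).
Proof. exact: sub_sigma_algebra. Qed.

Lemma measurable_Gam : measurable (Gam : set (borel_aut e)).
Proof.
by rewrite -[Gam]setCK; apply: measurableC; apply: measurable_open;
   exact: closed_openC.
Qed.

Lemma measurable_ev x (D : set V) :
  measurable ([set g | D (g x)] : set (borel_aut e)).
Proof. by apply: measurable_open; exact: open_aut_ev. Qed.

(** By transitivity this is a left coset of the stabilizer of [x] and a right coset of the
    stabilizer of [u]. *)
Definition tr x u : set (borel_aut e) := [set g : aut e | Gam g /\ g x = u].

Definition tr2 x u y v : set (borel_aut e) := tr x u `&` tr y v.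

Lemma measurable_tr x u : measurable (tr x u).
Proof.
by apply: measurableI; [exact: measurable_Gam|exact: (@measurable_ev x [set u])].
Qed.

Lemma measurable_tr2 x u y v : measurable (tr2 x u y v).
Proof. by apply: measurableI; exact: measurable_tr. Qed.

Lemma mu_tr2_left g x u y v : Gam g -> mu (tr2 x (g u) y (g v)) = mu (tr2 x u y v).
Proof.
move=> Gg; case: mu_haar => _ _ /(_ g (tr2 x u y v) Gg) <-; last first.
  by split; [exact: measurable_tr2|move=> ? [[]]].
congr (mu _); apply/seteqP; split => h.
  move=> [[Gh hx] [_ hy]]; exists (g^-1 * h)%g; last by rewrite mulVKg.
  by have Gh' := GamM (GamV Gg) Gh; split; split => //; rewrite autME ?hx ?hy aut_invK.
move=> [a [[Ga ax] [_ ay]] <-].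
by have Gh' := GamM Gg Ga; split; split => //; rewrite autME ?ax ?ay.
Qed.

Lemma mu_tr_left g x u : Gam g -> mu (tr x (g u)) = mu (tr x u).
Proof. by move=> Gg; have := @mu_tr2_left g x u x u Gg; rewrite /tr2 !setIid. Qed.

Lemma mu_tr_right g x u : Gam g -> mu (tr (g x) u) = mu (tr x u).
Proof.
move=> Gg; rewrite -(mu_right (GamV Gg) (A := tr x u)); last first.
  by split; [exact: measurable_tr|move=> ? []].
congr (mu _); apply/seteqP; split => h.
  move=> [Gh hx]; exists (h * g)%g; last by rewrite mulgK.
  by split => //; exact: GamM.
move=> [a [Ga ax] <-]; split; first by apply: GamM => //; exact: GamV.
by rewrite autME aut_invK.
Qed.

(** Left invariance moves the target and right invariance the source. Unimodularity enters the
    argument here. *)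
Lemma mu_tr x u y v : mu (tr x u) = mu (tr y v).
Proof.
have [g Gg <-] := Gam_trans v u; have [h Gh <-] := Gam_trans y x.
by rewrite mu_tr_left// mu_tr_right.
Qed.

(** All these cosets have the mass of the stabilizer of [x] in [Gam], which is compact, and a Radon
    measure is finite on compact sets. *)
Lemma mu_tr_lty x u : (mu (tr x u) < +oo)%E.
Proof.
rewrite (mu_tr x u x x).
case: mu_haar => _ [mu_cpt _ _] _; apply: mu_cpt => [|? []//].
have -> : tr x x = [set g : aut e | g x = x] `&` Gam by rewrite setIC.
by apply: compact_closedI => //; exact: compact_stabilizer.
Qed.

(** Balls exhaust [V], so [Gam] is a countable union of such cosets, all of the same mass. If one
    were null, [Gam] would be null. *)
Lemma mu_tr_neq0 x u : mu (tr x u) != 0%E.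
Proof.
apply/negP => /eqP mu0; case: mu_haar => /eqP mGam _ _; apply: mGam.
apply: measure_negligible; first exact: measurable_Gam.
have -> : Gam = \bigcup_n \bigcup_(y in [set` gball e x n]) tr x y.
  apply/seteqP; split => [g Gg|g [n _ [y _ []//]]].
  by exists (gdist e x (g x)) => //; exists (g x) => //=; rewrite in_gball.
apply: negligible_bigcup => n; rewrite bigcup_fset.
elim/big_ind: _ => [|? ? ? ?|y _]; first exact: negligible_set0.
  exact: negligibleU.
exists (tr x y); split => //; first exact: measurable_tr.
by rewrite (mu_tr x y x u).
Qed.

(** Real-valued masses allow linear arithmetic. As [fine] sends an infinite mass to 0, comparisons
    go through [mfinite]. *)
Definition nu (S : set (borel_aut e)) : R := fine (mu S).

Definition mfinite (S : set (borel_aut e)) := measurable S /\ (mu S < +oo)%E.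

Lemma mfiniteS (S S' : set (borel_aut e)) :
  mfinite S' -> measurable S -> S `<=` S' -> mfinite S.
Proof.
move=> [mS' S'oo] mS SS'; split => //; apply: le_lt_trans S'oo.
by rewrite le_measure ?inE.
Qed.

Lemma nu_ge0 (S : set (borel_aut e)) : 0 <= nu S.
Proof. exact/fine_ge0/measure_ge0. Qed.

Lemma muE (S : set (borel_aut e)) : mfinite S -> mu S = (nu S)%:E.
Proof. by move=> [_ S1]; rewrite fineK// ge0_fin_numE ?measure_ge0. Qed.

Lemma nu_le (S S' : set (borel_aut e)) :
  mfinite S' -> measurable S -> S `<=` S' -> nu S <= nu S'.
Proof.
move=> gS' mS SS'; have gS := mfiniteS gS' mS SS'.
by rewrite -lee_fin -!muE// le_measure ?inE//; case: gS'.
Qed.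

Lemma nuU_le (S S1 S2 : set (borel_aut e)) :
  measurable S -> mfinite S1 -> mfinite S2 -> S `<=` S1 `|` S2 ->
  nu S <= nu S1 + nu S2.
Proof.
move=> mS g1 g2 SS; have [m1 l1] := g1; have [m2 l2] := g2.
have mU : measurable (S1 `|` S2) by exact: measurableU.
have lU : (mu (S1 `|` S2) <= mu S1 + mu S2)%E by exact: measureU2.
have gU : mfinite (S1 `|` S2).
  by split => //; apply: le_lt_trans lU _; rewrite lte_add_pinfty.
apply: le_trans (nu_le gU mS SS) _.
by rewrite -lee_fin EFinD -!muE.
Qed.

Lemma nu_fibers (I : choiceType) (D : {fset I}) (k : borel_aut e -> I)
    (S : set (borel_aut e)) : mfinite S ->
  (forall i, measurable (S `&` k @^-1` [set i])) ->
  (forall g, S g -> k g \in D) ->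
  nu S = \sum_(i <- D) nu (S `&` k @^-1` [set i]).
Proof.
move=> gS mS SD; apply: EFin_inj; rewrite -muE// (measure_fibers mu mS SD).
rewrite -sumEFin; apply: eq_bigr => i _; rewrite muE//.
by apply: mfiniteS gS _ _ => // ? [].
Qed.

Context (o : V).

Definition stab_mass : R := nu (tr o o).
Local Notation m := stab_mass.

Lemma mfinite_tr x u : mfinite (tr x u).
Proof. by split; [exact: measurable_tr|exact: mu_tr_lty]. Qed.

Lemma nu_tr x u : nu (tr x u) = m.
Proof. by rewrite /m /nu (mu_tr x u o o). Qed.

Lemma stab_mass_gt0 : 0 < m.
Proof.
rewrite lt_neqAle nu_ge0 andbT eq_sym -eqe -muE ?mu_tr_neq0//.
exact: mfinite_tr.
Qed.

Definition inside x A : set (borel_aut e) := [set g : aut e | Gam g /\ g x \in A].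

Definition cross x y A : set (borel_aut e) :=
  [set g : aut e | [/\ Gam g, g x \in A & g y \notin A]].

Lemma measurable_inside x A : measurable (inside x A).
Proof.
apply: measurableI; first exact: measurable_Gam.
exact: (@measurable_ev x [set u | u \in A]).
Qed.

Lemma measurable_cross x y A : measurable (cross x y A).
Proof.
have -> : cross x y A = inside x A `&` [set g : aut e | g y \notin A].
  by apply/seteqP; split => [g [? ? ?]|g [[? ?] ?]].
apply: measurableI; first exact: measurable_inside.
exact: (@measurable_ev y [set u | u \notin A]).
Qed.

Lemma inside_fiber x A u :
  inside x A `&` (fun g : aut e => g x) @^-1` [set u] =
  if u \in A then tr x u else set0.
Proof.
case: ifPn => uA; apply/seteqP; split => [g|g] //=.
- by move=> [[Gg _] gx]; split.
- by move=> [Gg gx]; split => //; split => //; rewrite /= gx.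
- by move=> [[_ gA] gx]; rewrite gx (negPf uA) in gA.
Qed.

Lemma mu_inside x A : mu (inside x A) = (#|` A|%:R * m)%:E.
Proof.
rewrite (@measure_fibers _ _ _ mu _ A (fun g : aut e => g x)).
- rewrite big_seq (eq_bigr (fun=> m%:E)); last first.
    by move=> u uA; rewrite inside_fiber uA muE ?nu_tr//; exact: mfinite_tr.
  rewrite -big_seq sumEFin big_const_seq count_predT iter_addr addr0.
  by rewrite mulr_natl.
- move=> u; rewrite inside_fiber; case: ifP => _ //; exact: measurable_tr.
- by move=> g [].
Qed.

Lemma mfinite_inside x A : mfinite (inside x A).
Proof. by split; [exact: measurable_inside|rewrite mu_inside ltry]. Qed.

Lemma nu_inside x A : nu (inside x A) = #|` A|%:R * m.
Proof. by rewrite /nu mu_inside. Qed.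

Lemma mfinite_cross x y A : mfinite (cross x y A).
Proof.
apply: (mfiniteS (mfinite_inside x A) (measurable_cross x y A)).
by move=> g [].
Qed.

Lemma nu_cross_trans x y z A :
  nu (cross x z A) <= nu (cross x y A) + nu (cross y z A).
Proof.
apply: nuU_le; [exact: measurable_cross|exact: mfinite_cross|exact: mfinite_cross|].
move=> g [Gg gx gz]; case: (boolP (g y \in A)) => gy; [right|left]; split => //.
Qed.

(** If [tr2 x u y v] is nonempty, left invariance gives it the mass of each [tr2 x o y w] with [w]
    in [D]. These sets are disjoint and lie in [tr x o], of mass [m]. *)
Lemma nu_tr2_card x u y v (D : {fset V}) :
  (forall w, w \in D -> exists g, [/\ Gam g, g x = o & g y = w]) ->
  #|` D|%:R * nu (tr2 x u y v) <= m.
Proof.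
move=> HD; have [->|/set0P[g0 [[Gg0 <-] [_ <-]]]] := eqVneq (tr2 x u y v) set0.
  by rewrite /nu measure0 mulr0 nu_ge0.
have gto : mfinite (tr x o) by exact: mfinite_tr.
pose S : set (borel_aut e) := tr x o `&` [set g : aut e | g y \in D].
have mS : measurable S.
  apply: measurableI; first exact: measurable_tr.
  exact: (@measurable_ev y [set w | w \in D]).
have gS : mfinite S by apply: (mfiniteS gto mS); exact: subIsetl.
rewrite -(nu_tr x o); apply: le_trans (_ : nu S <= _); last first.
  exact: (nu_le gto mS (@subIsetl _ _ _)).
rewrite (@nu_fibers _ D (fun g : aut e => g y) S) //; last 2 first.
- by move=> w; apply: measurableI; [exact: mS|exact: (@measurable_ev y [set w])].
- by move=> g [].
rewrite mulr_natl -[X in X <= _]addr0 -iter_addr -count_predT -big_const_seq.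
rewrite big_seq [leRHS]big_seq; apply: ler_sum => w wD.
have [g [Gg gx gy]] := HD w wD.
have -> : nu (tr2 x (g0 x) y (g0 y)) = nu (tr2 x (g x) y (g y)).
  have -> : tr2 x (g x) y (g y) =
     tr2 x ((g * g0^-1)%g (g0 x)) y ((g * g0^-1)%g (g0 y)).
    by congr tr2; rewrite autME aut_invK.
  by rewrite /nu (@mu_tr2_left (g * g0^-1)%g)//; apply: GamM => //; exact: GamV.
rewrite gx gy; apply: nu_le; last 1 first.
- by move=> h [[Gh hx] [_ hy]]; do !split => //=; rewrite hy.
- apply: (mfiniteS gS); last by move=> ? [].
  by apply: measurableI => //; exact: (@measurable_ev y [set w]).
- exact: measurable_tr2.
Qed.

Definition out_nbrs A x : {fset V} := fset_set (neighbours e x `\` [set` A]).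

Lemma in_out_nbrs A x y : (y \in out_nbrs A x) = e x y && (y \notin A).
Proof.
rewrite in_fset_set; last first.
  by apply: sub_finite_set (e_fin x) => z [].
apply/idP/idP => [/set_mem[/= -> /negP]//|/andP[xy yA]].
by apply/mem_set; split => //; exact/negP.
Qed.

Definition edge_boundary A : R := \sum_(x <- A) #|` out_nbrs A x|%:R.

(** Split according to the image edge (u, v), which leaves [A]: there are [edge_boundary A] such
    edges, and each is hit with mass at most m / M by [nu_tr2_card]. The sets [D] in the hypothesis
    are the finite sets equal to [E] below, the neighbours of [o] reached by the orbit of (x, y). *)
Lemma nu_cross_edge x y A (M : R) : e x y ->
  (forall (D : {fset V}), (forall w, (w \in D) =
     `[< exists g, [/\ Gam g, g x = o & g y = w] >]) -> M <= #|` D|%:R) ->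
  M * nu (cross x y A) <= edge_boundary A * m.
Proof.
move=> xy HM.
pose E := [set w | exists g, [/\ Gam g, g x = o & g y = w]].
have Efin : finite_set E.
  apply: sub_finite_set (e_fin o) => w [g [_ <- <-]].
  by have [_ ge] := autP g; rewrite /neighbours /= ge.
have MD : M <= #|` fset_set E|%:R.
  by apply: HM => w; rewrite in_fset_set//; apply/idP/asboolP => [/set_mem|/mem_set].
have key u v : M * nu (tr2 x u y v) <= m.
  apply: le_trans (ler_wpM2r (nu_ge0 _) MD) _.
  by apply: nu_tr2_card => w; rewrite in_fset_set// => /set_mem.
rewrite (@nu_fibers _ A (fun g : aut e => g x)); last 3 first.
- exact: mfinite_cross.
- move=> u; apply: measurableI; first exact: measurable_cross.
  exact: (@measurable_ev x [set u]).
- by move=> g [].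
rewrite /edge_boundary mulr_sumr mulr_suml; apply: ler_sum => u _.
have gu : mfinite (cross x y A `&` (fun g : aut e => g x) @^-1` [set u]).
  apply: (mfiniteS (mfinite_cross x y A)); last by move=> ? [].
  apply: measurableI; first exact: measurable_cross.
  exact: (@measurable_ev x [set u]).
rewrite (@nu_fibers _ (out_nbrs A u) (fun g : aut e => g y)) //; last 2 first.
- move=> v; apply: measurableI; first by case: gu.
  exact: (@measurable_ev y [set v]).
- move=> g [[Gg gx gy] /= <-]; rewrite in_out_nbrs gy andbT.
  by have [_ ->] := autP g.
have -> : #|` out_nbrs A u|%:R * m = \sum_(v <- out_nbrs A u) m.
  by rewrite big_const_seq count_predT iter_addr addr0 mulr_natl.
rewrite mulr_sumr; apply: ler_sum => v _.
(* Enlarging the event to [tr2 x u y v] needs M >= 0; for negative [M] the left side is at most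
   0. *)
have [M0|M0] := leP 0 M; last first.
  apply: (@le_trans _ _ 0); last exact: nu_ge0.
  by rewrite nmulr_rle0// nu_ge0.
apply: le_trans (key u v); rewrite ler_wpM2l//; apply: nu_le.
- apply: (mfiniteS (mfinite_tr x u)); first exact: measurable_tr2.
  by move=> g [].
- apply: measurableI; first by case: gu.
  exact: (@measurable_ev y [set v]).
- by move=> g [[[Gg _ _] /= gx] gy].
Qed.

(** If the image of a walk starts in [A] and ends outside, one of its steps leaves [A]. *)
Lemma nu_cross_walk x y n A (C : R) :
  (forall u v, e u v -> nu (cross u v A) <= C) ->
  walk_of_length e x y n -> nu (cross x y A) <= n%:R * C.
Proof.
move=> HC [p [pp <- <-]]; elim: p x pp => [|z p IH] x /=.
  move=> _; rewrite mul0r; have -> : cross x x A = set0.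
    by apply/seteqP; split => // g [_ gx /negP].
  by rewrite /nu measure0.
move=> /andP[xz zp]; apply: le_trans (nu_cross_trans x z _ A) _.
by rewrite -natr1 mulrDl mul1r addrC lerD// ?IH// HC.
Qed.

(* Integrating over Gam the event that g o and g y both lie
   in A turns the sum over pairs (o, y) into a sum over pairs of points of A. *)
Lemma mass_transport_le (q : V -> V -> R) A B (th : R) :
  (forall x y, 0 <= q x y) ->
  (forall g x y, Gam g -> q x y <= q (g x) (g y)) ->
  (forall y, y \in B -> nu (cross o y A) <= th * (#|` A|%:R * m)) ->
  (\sum_(y <- B) q o y) * (#|` A|%:R * (1 - th))
    <= \sum_(x <- A) \sum_(z <- A) q x z.
Proof.
move=> q0 qg HB.
pose both y := inside o A `&` [set g : aut e | g y \in A].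
have mboth y : measurable (both y).
  apply: measurableI; first exact: measurable_inside.
  exact: (@measurable_ev y [set u | u \in A]).
have gboth y : mfinite (both y).
  by apply: (mfiniteS (mfinite_inside o A)) => // ? [].
have bothE y : nu (both y) = \sum_(x <- A) \sum_(z <- A) nu (tr2 o x y z).
  rewrite (@nu_fibers _ A (fun g : aut e => g o)) //; last 2 first.
  - move=> u; apply: measurableI; first exact: mboth.
    exact: (@measurable_ev o [set u]).
  - by move=> g [[]].
  rewrite big_seq [RHS]big_seq; apply: eq_bigr => x xA.
  have gx : mfinite (both y `&` (fun g : aut e => g o) @^-1` [set x]).
    apply: (mfiniteS (gboth y)); last by move=> ? [].
    apply: measurableI; first exact: mboth.
    exact: (@measurable_ev o [set x]).
  rewrite (@nu_fibers _ A (fun g : aut e => g y)) //; last 2 first.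
  - move=> u; apply: measurableI; first by case: gx.
    exact: (@measurable_ev y [set u]).
  - by move=> g [[]].
  rewrite big_seq [RHS]big_seq; apply: eq_bigr => z zA; congr nu.
  apply/seteqP; split => g.
    by move=> [[[[Gg _] _] /= gox] gyz].
  by move=> [[Gg gox] [_ gyz]]; do !split => //=; rewrite ?gox ?gyz.
(* Elements sending [o] into [A] have mass |A| m, and those that send [y] outside take away at most
   the fraction [th]. *)
have lower y : y \in B -> #|` A|%:R * (1 - th) * m <= nu (both y).
  move=> yB.
  have : nu (inside o A) <= nu (both y) + nu (cross o y A).
    apply: nuU_le; [exact: measurable_inside|exact: gboth|exact: mfinite_cross|].
    move=> g [Gg gx]; case: (boolP (g y \in A)) => gy; [left|right]; split => //.
  rewrite nu_inside; have := HB y yB; lra.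
rewrite -(ler_pM2r stab_mass_gt0).
apply: (@le_trans _ _ (\sum_(y <- B) q o y * nu (both y))).
  rewrite mulr_suml mulr_suml big_seq [leRHS]big_seq; apply: ler_sum => y yB.
  by rewrite -mulrA ler_wpM2l// lower.
have -> : \sum_(y <- B) q o y * nu (both y) =
  \sum_(x <- A) \sum_(z <- A) \sum_(y <- B) q o y * nu (tr2 o x y z).
  under eq_bigr do rewrite bothE mulr_sumr.
  rewrite exchange_big; apply: eq_bigr => x _.
  by under eq_bigr do rewrite mulr_sumr; rewrite exchange_big.
rewrite mulr_suml; apply: ler_sum => x _; rewrite mulr_suml; apply: ler_sum => z _.
(* Any [g] in [tr2 o x y z] transports (o, y) to (x, z), so the kernel at (o, y) is at most its
   value at (x, z). *)
apply: (@le_trans _ _ (\sum_(y <- B) q x z * nu (tr2 o x y z))).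
  apply: ler_sum => y _.
  have [->|/set0P[g [[Gg <-] [_ <-]]]] := eqVneq (tr2 o x y z) set0.
    by rewrite /nu measure0 !mulr0.
  by rewrite ler_wpM2r ?nu_ge0 ?qg.
rewrite -mulr_sumr ler_wpM2l//.
have gto : mfinite (tr o x) by exact: mfinite_tr.
(* For fixed [x] and [z] the sets [tr2 o x y z] are the fibres of g |-> g^-1 z, hence disjoint in
   [tr o x]; their masses add up to at most [m]. *)
pose S : set (borel_aut e) := tr o x `&` [set g : aut e | (g^-1)%g z \in B].
have SE (D : set V) : tr o x `&` [set g : aut e | D ((g^-1)%g z)] =
    \bigcup_(y in D) tr2 o x y z.
  apply/seteqP; split => g.
    move=> [[Gg gox] /= Dz]; exists ((g^-1)%g z) => //; split; split => //.
    exact: aut_invVK.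
  move=> [y Dy [[Gg gox] [_ <-]]]; split => //.
  by have : D ((g^-1)%g (g y)) by rewrite aut_invK.
have mS : measurable S.
  rewrite /S (SE [set y | y \in B]) bigcup_fset.
  by apply: bigsetU_measurable => y _; exact: measurable_tr2.
have gS : mfinite S by apply: (mfiniteS gto mS); exact: subIsetl.
have fib y : y \in B ->
    S `&` (fun g : aut e => (g^-1)%g z) @^-1` [set y] = tr2 o x y z.
  move=> yB; apply/seteqP; split => g.
    by move=> [[[Gg gox] _] /= <-]; split; split => //; exact: aut_invVK.
  move=> [[Gg gox] [_ gyz]]; have gV : (g^-1)%g z = y by rewrite -gyz aut_invK.
  have gB : (g^-1)%g z \in B by rewrite gV.
  by split.
rewrite -(nu_tr o x); apply: le_trans (_ : nu S <= _); last first.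
  exact: (nu_le gto mS (@subIsetl _ _ _)).
rewrite (@nu_fibers _ B (fun g : aut e => (g^-1)%g z) S) //; last 2 first.
- move=> y; case: (boolP (y \in B)) => yB; first by rewrite fib//; exact: measurable_tr2.
  rewrite (_ : _ `&` _ = set0)//; apply/seteqP; split => // g [[_ /= gB] gz].
  by rewrite gz (negPf yB) in gB.
- by move=> g [].
by rewrite big_seq [leRHS]big_seq; apply: ler_sum => y yB; rewrite fib.
Qed.

End HaarCounting.

(** * Random walks *)

Section RandomWalk.
Context {R : realType} {V : choiceType} (e : rel V) (o : V).
Context (e_fin : locally_finite e) (e_conn : graph_connected e).
Context (Q : V -> V -> R).
Context (Q_ge0 : forall x y, 0 <= Q x y).
Context (Q_sub : forall x (W : {fset V}), \sum_(y <- W) Q x y <= 1).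
Context (d : measure_display) (Om : measurableType d) (Pr : probability Om R).
Context (X : nat -> Om -> V) (X_walk : random_walk Pr Q X).
Implicit Types (W : {fset V}) (s : nat -> V).

(** Writes any set of vertices as a countable union of finite unions of singletons or empty sets;
    the definition of a random walk gives measurability only for singletons. *)
Lemma bigcup_gball (D : set V) :
  D = \bigcup_n \bigcup_(x in [set` gball e o n]) (D `&` [set x]).
Proof.
apply/seteqP; split => [x Dx|x [n _ [y _ [Dx _]]]//].
by exists (gdist e o x) => //; exists x => //=; rewrite in_gball.
Qed.

Lemma measurable_walk n (D : set V) : measurable (X n @^-1` D).
Proof.
rewrite (bigcup_gball D) preimage_bigcup; apply: bigcupT_measurable => m.
rewrite preimage_bigcup bigcup_fset; apply: bigsetU_measurable => x _.
have [xD|xD] := pselect (D x).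
  rewrite (_ : D `&` [set x] = [set x]); first exact: X_walk.1.
  by apply/seteqP; split => [y []|y ->].
rewrite (_ : D `&` [set x] = set0) ?preimage_set0//.
by apply/seteqP; split => // y [Dy yx]; apply: xD; rewrite -yx.
Qed.

Lemma measurable_walks (D : nat -> set V) :
  measurable [set w | forall n, D n (X n w)].
Proof.
rewrite (_ : [set w | _] = \bigcap_n (X n @^-1` D n)).
  by apply: bigcapT_measurable => n; exact: measurable_walk.
by apply/seteqP; split => [w H n _|w H n]; exact: H.
Qed.

Lemma measurable_walk_rel m n (r : V -> V -> Prop) :
  measurable [set w | r (X m w) (X n w)].
Proof.
rewrite (_ : [set w | _] = \bigcup_i \bigcup_(x in [set` gball e o i])
    ((X m @^-1` [set x]) `&` (X n @^-1` [set y | r x y]))).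
  apply: bigcupT_measurable => i; rewrite bigcup_fset.
  apply: bigsetU_measurable => x _; apply: measurableI; exact: measurable_walk.
apply/seteqP; split => w /=; last by move=> [i _ [x _ [/= <-]]].
move=> rw; exists (gdist e o (X m w)) => //; exists (X m w) => //=.
by rewrite in_gball.
Qed.

Definition walk_cyl s n : set Om := [set w | forall i, (i <= n)%N -> X i w = s i].

(** The position at time [n] is not confined to [W], just as [trunc_op] does not confine its
    argument. The single quantifier over times fits [measurable_walks]. *)
Definition walk_within W s n m y : set Om :=
  [set w | forall i, [/\ (i <= n)%N -> X i w = s i,
    (n < i <= n + m)%N -> X i w \in W & i = (n + m)%N -> X i w = y]].

Lemma measurable_walk_within W s n m y : measurable (walk_within W s n m y).
Proof.
exact: (@measurable_walks (fun i => [set x | [/\ (i <= n)%N -> x = s i,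
    (n < i <= n + m)%N -> x \in W & i = (n + m)%N -> x = y]])).
Qed.

Lemma measurable_walk_cyl s n : measurable (walk_cyl s n).
Proof. exact: (@measurable_walks (fun i => [set x | (i <= n)%N -> x = s i])). Qed.

(** Induction on [m], splitting by the position at time n + 1, which lies in [W]: the Markov
    property contributes the factor of [Q], and the remaining [m] steps start from the extended
    history. *)
Lemma walk_within_le W s n m y :
  (Pr (walk_within W s n m y)
     <= Pr (walk_cyl s n) * (iter m (trunc_op Q W) (delta y) (s n))%:E)%E.
Proof.
elim: m n s => [|m IH] n s.
  rewrite /= /delta; have [sy|/eqP sy] := eqVneq (s n) y.
    rewrite mule1 le_measure ?inE//.
    - exact: measurable_walk_within.
    - exact: measurable_walk_cyl.
    - by move=> w H i; case: (H i).
  rewrite mule0 (_ : walk_within _ _ _ _ _ = set0) ?measure0//.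
  apply/seteqP; split => // w H; case: (H n) => /(_ (leqnn n)) -> _.
  by rewrite addn0 => /(_ erefl).
rewrite (@measure_fibers _ _ _ Pr _ W (X n.+1)); last 2 first.
- move=> z; apply: measurableI; first exact: measurable_walk_within.
  exact: measurable_walk.
- by move=> w H; case: (H n.+1) => _ + _; apply; rewrite ltnSn addnS ltnS leq_addr.
(* The history [s] with its value at time n + 1 replaced by [z]. *)
pose s' z i := if i == n.+1 then z else s i.
have cylS z : Pr (walk_cyl (s' z) n.+1) = (Pr (walk_cyl s n) * (Q (s n) z)%:E)%E.
  rewrite /walk_cyl X_walk.2 /s' eqxx (ltn_eqF (ltnSn n)).
  congr (Pr _ * _)%E; apply/seteqP; split => w H i ni; have := H i ni;
  by rewrite (ltn_eqF (_ : i < n.+1)%N).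
rewrite -(fineK (_ : Pr (walk_cyl s n) \is a fin_num)); last first.
  by rewrite fin_num_measure//; exact: measurable_walk_cyl.
rewrite -EFinM /= {2}/trunc_op mulr_sumr -sumEFin.
rewrite big_seq [leRHS]big_seq; apply: lee_sum => z zW.
apply: (@le_trans _ _ (Pr (walk_within W (s' z) n.+1 m y))).
  apply: le_measure; rewrite ?inE.
  - apply: measurableI; first exact: measurable_walk_within.
    exact: measurable_walk.
  - exact: measurable_walk_within.
  - move=> w [H /= wz] i; case: (H i) => H1 H2 H3; split.
    + rewrite /s' leq_eqVlt => /orP[/eqP ->|ni]; first by rewrite eqxx.
      by rewrite (ltn_eqF ni) H1.
    + by move=> /andP[ni im]; apply: H2; rewrite (ltnW ni) addnS -addSn.
    + by move=> im; apply: H3; rewrite addnS -addSn.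
apply: (le_trans (IH _ _)); rewrite cylS /s' eqxx.
rewrite -(fineK (_ : Pr (walk_cyl s n) \is a fin_num)); last first.
  by rewrite fin_num_measure//; exact: measurable_walk_cyl.
by rewrite -!EFinM lee_fin fineK ?mulrA// fin_num_measure//; exact: measurable_walk_cyl.
Qed.

(** Restricting to trajectories that stay in a ball about [o] up to time [k] leaves finitely many
    starting points and compares the walk with a finite truncation. The bound is uniform in the
    ball, so continuity from below concludes. *)
Lemma walk_displacement_le k r (p : R) : 0 <= p ->
  (forall x, \sum_(y <- gball e x r) kernel_pow Q k x y <= p) ->
  (Pr [set w | (gdist e (X 0%N w) (X k w) <= r)%N] <= p%:E)%E.
Proof.
move=> p0 Hp; set Ev := [set w | _].
have mEv : measurable Ev.
  exact: (@measurable_walk_rel 0 k (fun x y => (gdist e x y <= r)%N)).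
pose F n := Ev `&` [set w | forall i, (i <= k)%N -> X i w \in gball e o n].
have mF n : measurable (F n).
  apply: measurableI => //.
  exact: (@measurable_walks (fun i => [set x | (i <= k)%N -> x \in gball e o n])).
have EvE : Ev = \bigcup_n F n.
  apply/seteqP; split => [w Ew|w [n _ []]//].
  exists (\max_(i < k.+1) gdist e o (X i w)) => //; split => // i ik.
  rewrite in_gball//.
  exact: (leq_bigmax_cond (F := fun i : 'I_k.+1 => gdist e o (X i w))
    (Ordinal (ik : i < k.+1)%N)).
have ndF : nondecreasing_seq F.
  move=> a b ab; apply/subsetPset => w [Ew H]; split => // i ik.
  by have := H i ik; rewrite !in_gball// => /leq_trans; apply.
have cvF : Pr \o F @ \oo --> Pr Ev.
  by rewrite EvE; apply: nondecreasing_cvg_mu => //; rewrite -EvE.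
rewrite -(cvg_lim _ cvF)//; apply: lime_le; first by apply/cvg_ex; exists (Pr Ev).
apply: nearW => n /=; set W := gball e o n.
have W0 w : F n w -> X 0 w \in W by move=> [_ /(_ 0 (leq0n k))].
have mX0 x : measurable (F n `&` X 0 @^-1` [set x]).
  by apply: measurableI => //; exact: measurable_walk.
rewrite (@measure_fibers _ _ _ Pr _ W (X 0)) //.
apply: (@le_trans _ _ (\sum_(x <- W) Pr (walk_cyl (fun=> x) 0) * p%:E)%E).
  apply: lee_sum => x _.
  rewrite (@measure_fibers _ _ _ Pr _ (gball e x r) (X k)); last 2 first.
  - by move=> y; apply: measurableI => //; exact: measurable_walk.
  - by move=> w [[Ew _] /= <-]; rewrite in_gball.
  apply: (@le_trans _ _ (\sum_(y <- gball e x r)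
      Pr (walk_cyl (fun=> x) 0) * (kernel_pow Q k x y)%:E)%E).
    apply: lee_sum => y _; apply: (@le_trans _ _ (Pr (walk_within W (fun=> x) 0 k y))).
      apply: le_measure; rewrite ?inE.
      - by apply: measurableI => //; exact: measurable_walk.
      - exact: measurable_walk_within.
      - move=> w [[[_ Hw] /= wx] wy] i; split.
        + by rewrite leqn0 => /eqP ->.
        + by rewrite add0n => /andP[_ /Hw].
        + by rewrite add0n => ->.
    apply: (le_trans (walk_within_le _ _ _ _ _)).
    by rewrite lee_wpmul2l// lee_fin; exact: trunc_le_kernel_pow.
  rewrite -ge0_sume_distrr; last by move=> y _; rewrite lee_fin kernel_pow_ge0.
  by rewrite lee_wpmul2l// sumEFin lee_fin.
rewrite -ge0_sume_distrl//.
rewrite -[leRHS]mul1e lee_wpmul2r//.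
(* The weights of the starting points in [W] are masses of disjoint events, so they sum to at most 1
   whatever the law of [X 0]. *)
pose S := X 0 @^-1` [set y | y \in W].
rewrite big_seq (eq_bigr (fun x => Pr (S `&` X 0 @^-1` [set x]))); last first.
  move=> x xW; congr (Pr _); apply/seteqP; split => [w H|w [_ wx] i].
    have wx := H 0 (leqnn 0).
    by split => //; have : X 0 w \in W by rewrite wx.
  by rewrite leqn0 => /eqP ->.
rewrite -big_seq -measure_fibers//; first exact/probability_le1/measurable_walk.
by move=> x; apply: measurableI; exact: measurable_walk.
Qed.

End RandomWalk.

(** * Profiles *)

Lemma sum_fset_le_esum (R : realType) (T : choiceType) (S : set T) (A : {fset T})
    (f : T -> R) : [set` A] `<=` S ->
  ((\sum_(x <- A) f x)%:E <= \esum_(x in S) (f x)%:E)%E.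
Proof.
move=> AS; apply: esum_ge; exists [set` A]; first by split.
by rewrite -fsbig_seq// sumEFin.
Qed.

Section SpectralProfile.
Context {R : realType} {V : choiceType} (Q : V -> V -> R).
Context (Q_stoch : stochastic Q) (Q_sym : symmetric_kernel Q).
Implicit Types (A : {fset V}) (f g : V -> R).

Lemma stochastic_ge0 x y : 0 <= Q x y.
Proof. by case: Q_stoch => /(_ x y)/andP[]. Qed.

Lemma stochastic_sum_le x A : \sum_(y <- A) Q x y <= 1.
Proof.
by rewrite -lee_fin; case: Q_stoch => _ /(_ x) <-; exact: sum_fset_le_esum.
Qed.

Lemma inner_supp A f g : (forall x, x \notin A -> f x = 0) ->
  inner g f = dot A g f.
Proof.
move=> fA; rewrite /inner -(@fsbig_widen _ _ _ _ [set` A])//.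
  by rewrite -fsbig_seq.
by move=> x [_ /negP xA]; rewrite /preimage /= fA ?mulr0.
Qed.

Lemma kernel_op_supp A f x : (forall x, x \notin A -> f x = 0) ->
  kernel_op Q f x = trunc_op Q A f x.
Proof.
move=> fA; rewrite /kernel_op -(@fsbig_widen _ _ _ _ [set` A])//.
  by rewrite -fsbig_seq.
by move=> y [_ /negP yA]; rewrite /preimage /= fA ?mulr0.
Qed.

(** Links the profile to truncations: for functions supported in [A], only the values of [Q] on [A]
    matter. *)
Lemma dirichlet_supp A f : (forall x, x \notin A -> f x = 0) ->
  inner (fun x => f x - kernel_op Q f x) f = dot A f f - dot A (trunc_op Q A f) f.
Proof.
move=> fA; rewrite (inner_supp _ fA) -sumrB; apply: eq_bigr => x _.
by rewrite (kernel_op_supp _ fA) mulrBl.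
Qed.

Lemma lambda_ge0 A : (0 <= lambda Q A)%E.
Proof.
apply: le_ereal_inf_tmp => _ [f [fA _] <-].
rewrite (dirichlet_supp fA) lee_fin subr_ge0.
exact: (dot_trunc_op_le stochastic_ge0 Q_sym stochastic_sum_le).
Qed.

Lemma spectral_profile_ge0 N : (0 <= spectral_profile Q N)%E.
Proof. by apply: le_ereal_inf_tmp => _ [A _ <-]; exact: lambda_ge0. Qed.

(** The test function [delta o] has Rayleigh quotient 1 - Q(o, o). *)
Lemma spectral_profile_le1 (o : V) N : 1 <= N -> (spectral_profile Q N <= 1)%E.
Proof.
move=> N1; pose A : {fset V} := [fset o]%fset.
apply: (@le_trans _ _ (lambda Q A)).
  apply: ereal_inf_lbound; exists A => //; split; last by rewrite cardfs1.
  by apply/fset0Pn; exists o; rewrite inE.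
have dA x : x \notin A -> @delta R V o x = 0.
  by rewrite inE /delta => /negPf ->.
apply: (@le_trans _ _
  (inner (fun x => delta o x - kernel_op Q (delta o) x) (delta o))%:E).
  apply: ereal_inf_lbound; exists (delta o) => //; split => //.
  rewrite /l2norm (inner_supp _ dA) /dot big_seq_fset1 /delta eqxx.
  by rewrite mulr1 sqrtr1.
rewrite (dirichlet_supp dA) lee_fin /dot big_seq_fset1 /trunc_op big_seq_fset1.
rewrite /delta eqxx !mulr1 gerBl; apply: sumr_ge0 => y _.
by rewrite mulr_ge0 ?stochastic_ge0.
Qed.

(** Restrict [g] to [A] and normalise it to get a competitor in the infimum. If its norm is 0, the
    contraction bound [dot_trunc_op_le] suffices. *)
Lemma spectral_gap_profile N (lam : R) :
  spectral_profile Q N = lam%:E -> spectral_gap Q N lam.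
Proof.
move=> Nlam A g AN.
have dgg : 0 <= dot A g g by apply: sumr_ge0 => x _; rewrite -expr2 sqr_ge0.
have [n0|n0] := eqVneq (dot A g g) 0.
  by rewrite n0 mulr0 -n0; exact: (dot_trunc_op_le stochastic_ge0 Q_sym stochastic_sum_le).
pose a := (Num.sqrt (dot A g g))^-1.
have a2 : a * a * dot A g g = 1.
  by rewrite /a -invfM -expr2 sqr_sqrtr// mulVf.
pose f x := if x \in A then a * g x else 0.
have fA x : x \notin A -> f x = 0 by rewrite /f => /negPf ->.
have dff : dot A f f = 1.
  rewrite -a2 mulr_sumr /dot big_seq [RHS]big_seq; apply: eq_bigr => x xA.
  by rewrite /f xA mulrACA.
have A0 : A != fset0.
  by apply: contra_neq n0 => ->; rewrite /dot big_seq_fset0.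
have : (lam%:E <= lambda Q A)%E.
  by rewrite -Nlam; apply: ereal_inf_lbound; exists A.
have : (lambda Q A <= (inner (fun x => f x - kernel_op Q f x) f)%:E)%E.
  apply: ereal_inf_lbound; exists f => //; split => //.
  by rewrite /l2norm (inner_supp _ fA) dff sqrtr1.
move=> /[swap] /le_trans/[apply]; rewrite (dirichlet_supp fA) lee_fin dff.
have -> : dot A (trunc_op Q A f) f = a * a * dot A (trunc_op Q A g) g.
  rewrite !dot_trunc_op mulr_sumr big_seq [RHS]big_seq; apply: eq_bigr => x xA.
  rewrite mulr_sumr big_seq [RHS]big_seq; apply: eq_bigr => y yA.
  by rewrite /f xA yA; ring.
have dpos : 0 < dot A g g by rewrite lt_neqAle eq_sym n0.
move=> H; have := ler_wpM2l dgg H.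
have -> : dot A g g * (1 - a * a * dot A (trunc_op Q A g) g) =
  dot A g g - (a * a * dot A g g) * dot A (trunc_op Q A g) g by ring.
by rewrite a2 mul1r; lra.
Qed.

End SpectralProfile.

(** * Isoperimetric sets and orbits of edges *)

Section Isoperimetry.
Context {R : realType} {V : choiceType} (e : rel V).
Context (e_fin : locally_finite e) (Gam : set (aut e)).
Context (Gam_trans : acts_transitively Gam) (o : V).
Implicit Types A : {fset V}.

Lemma in_neighbours x y : (y \in fset_set (neighbours e x)) = e x y.
Proof.
by rewrite in_fset_set//; apply/idP/idP => [/set_mem|/mem_set].
Qed.

Lemma degree_transitive x : degree e x = degree e o.
Proof.
have [g _ <-] := Gam_trans o x.
have [[h gK hK] ge] := autP g.
rewrite /degree (_ : neighbours e (g o) = g @` neighbours e o).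
  by rewrite fset_set_image// card_imfset//; exact: aut_inj.
apply/seteqP; split => [y /= goy|_ [y /= oy <-]]; last by rewrite /neighbours /= ge.
by exists (h y); rewrite ?hK// /neighbours /= -ge hK.
Qed.

(** By transitivity every boundary edge has weight 1 / deg(o) in the simple random walk. *)
Lemma edge_boundary_le_ratio A (x : R) : (0 < degree e o)%N -> A != fset0 ->
  (isoperimetric_ratio (srw e) A <= x%:E)%E ->
  @edge_boundary R V e A <= x * #|` A|%:R * (degree e o)%:R.
Proof.
move=> d0 A0; rewrite /isoperimetric_ratio.
have a0 : 0 < #|` A|%:R :> R by rewrite ltr0n cardfs_gt0.
have dR : 0 < (degree e o)%:R :> R by rewrite ltr0n.
rewrite lee_pdivrMr// => H.
rewrite -ler_pdivrMr// -lee_fin [leRHS]EFinM; apply: le_trans H.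
rewrite /edge_boundary mulr_suml -sumEFin; apply: lee_sum => u _.
apply: (@le_trans _ _ (\sum_(v <- out_nbrs e A u) @srw R V e u v)%:E); last first.
  apply: sum_fset_le_esum => v /=.
  by rewrite in_out_nbrs// => /andP[_ /negP].
rewrite lee_fin big_seq (eq_bigr (fun=> (degree e o)%:R^-1)); last first.
  by move=> v; rewrite in_out_nbrs// /srw degree_transitive => /andP[-> _].
by rewrite -big_seq big_const_seq count_predT iter_addr addr0 mulr_natl.
Qed.

(** Neither infimum need be attained, so the ratio is only reached up to [ep]. Cardinalities are
    integers, however, so the size bound is exact. *)
Lemma profile_inverse_approx (x t ep : R) : 0 < ep ->
  profile_inverse (isoperimetric_profile (srw e)) x = t%:E ->
  exists A, [/\ A != fset0, #|` A|%:R <= t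
    & (isoperimetric_ratio (srw e) A <= (x + ep)%:E)%E].
Proof.
move=> ep0 Ht.
have t0 : 0 <= t.
  rewrite -lee_fin -Ht; apply: le_ereal_inf_tmp => _ [s [s1 _] <-].
  by rewrite lee_fin (le_trans _ s1).
(* A parameter [s] below floor(t) + 1 is enough: |A| <= s then forces |A| <= floor(t). *)
have : (profile_inverse (isoperimetric_profile (srw e)) x < (Num.truncn t).+1%:R%:E)%E.
  by rewrite Ht lte_fin truncnS_gt.
move=> /ereal_inf_lt[_ [s [s1 sx] <-]]; rewrite lte_fin => st.
have : (isoperimetric_profile (srw e) s < (x + ep)%:E)%E.
  by apply: le_lt_trans sx _; rewrite lte_fin ltrDl.
move=> /ereal_inf_lt[_ [A [A0 As] <-]] /ltW Ax; exists A; split => //.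
rewrite -truncn_ge_nat// -ltnS -(ltr_nat R); exact: le_lt_trans As st.
Qed.

Lemma profile_inverse_ge1 (x t : R) :
  profile_inverse (isoperimetric_profile (srw e)) x = t%:E -> 1 <= t.
Proof.
move=> Ht; rewrite -lee_fin -Ht; apply: le_ereal_inf_tmp => _ [s [s1 _] <-].
by rewrite lee_fin.
Qed.

Definition min_orbit : R :=
  inf [set #|` fset_set (edge_orbit Gam a `&` oriented_edges_from e o)|%:R |
        a in oriented_edges e].

Lemma card_edge_orbit x y (D : {fset V}) : e x y ->
  (forall w, (w \in D) = `[< exists g, [/\ Gam g, g x = o & g y = w] >]) ->
  #|` fset_set (edge_orbit Gam (x, y) `&` oriented_edges_from e o)| = #|` D|.
Proof.
move=> xy HD.
have -> : edge_orbit Gam (x, y) `&` oriented_edges_from e o = pair o @` [set` D].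
  apply/seteqP; split => [_ [[g Gg <-] [/= _ gx]]|_ [w /= wD <-]].
    by exists (g y) => /=; [rewrite HD; apply/asboolP; exists g|rewrite gx].
  move: wD; rewrite HD => /asboolP[g [Gg gx <-]]; split => /=.
    by exists g => //; rewrite gx.
  by split => //; rewrite -gx; have [_ ->] := autP g.
rewrite fset_set_image// set_fsetK card_imfset// => ? ? [] //.
Qed.

Lemma min_orbit_le x y (D : {fset V}) : e x y ->
  (forall w, (w \in D) = `[< exists g, [/\ Gam g, g x = o & g y = w] >]) ->
  min_orbit <= #|` D|%:R.
Proof.
move=> xy HD; apply: ge_inf; first by exists 0 => _ [a _ <-].
by exists (x, y) => //; rewrite (card_edge_orbit xy HD).
Qed.

(** By transitivity every orbit contains an edge starting at [o]. The given edge matters because the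
    real infimum of the empty set is 0. *)
Lemma min_orbit_ge1 x y : e x y -> 1 <= min_orbit.
Proof.
move=> xy; apply: lb_le_inf; first by eexists; exists (x, y).
move=> _ [[u v] /= uv <-].
pose D := fset_set [set w | exists g : aut e, [/\ Gam g, g u = o & g v = w]].
have Efin : finite_set [set w | exists g : aut e, [/\ Gam g, g u = o & g v = w]].
  apply: sub_finite_set (e_fin o) => w [g [_ <- <-]].
  by have [_ ge] := autP g; rewrite /neighbours /= ge.
have HD w : (w \in D) = `[< exists g, [/\ Gam g, g u = o & g v = w] >].
  by rewrite in_fset_set//; apply/idP/asboolP => [/set_mem|/mem_set].
rewrite (card_edge_orbit uv HD) ler1n cardfs_gt0; apply/fset0Pn.
have [g Gg gu] := Gam_trans u o.
by exists (g v); rewrite HD; apply/asboolP; exists g.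
Qed.

End Isoperimetry.

(** With s = 2^(-L/2) the claim becomes 3 s - 2 s^3 <= 1. It holds for s^2 <= 1/8, that is L >= 3,
    but fails at L = 2. *)
Lemma decay_bound (R : realType) (L : nat) : (2 < L)%N ->
  (2 : R) ^- L * (3 - 2 * 2 ^- L) <= expR (- (ln 2 / 2 * L%:R)).
Proof.
move=> L3; set s := expR _.
have s0 : 0 < s by exact: expR_gt0.
have -> : (2 : R) ^- L = s * s.
  rewrite /s -expRD -[in LHS](lnK (_ : (2 : R) \is Num.pos)) ?posrE//.
  by rewrite -expRM_natr -expRN; congr expR; field.
have : s * s <= 8^-1.
  have -> : s * s = (2 : R) ^- L.
    rewrite /s -expRD -[in RHS](lnK (_ : (2 : R) \is Num.pos)) ?posrE//.
    by rewrite -expRM_natr -expRN; congr expR; field.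
  rewrite lef_pV2 ?posrE ?exprn_gt0//.
  have -> : (8 : R) = 2 ^+ 3 by rewrite -natrX.
  by rewrite ler_eXn2l// ltr1n.
(* The number 9/25 is slightly above the square root of 1/8. The product in the next line is s^3
   minus its tangent line at 9/25, which reduces the claim to a linear one. *)
move=> s8; have s36 : s <= 9 / 25 by nra.
have := mulr_ge0 (sqr_ge0 (s - 9 / 25)) (_ : 0 <= s + 18 / 25).
by move=> /(_ ltac:(lra)) H; nra.
Qed.

(** * Return probability to a ball *)

Section MainBound.
Context {R : realType} {V : choiceType} (e : rel V) (o : V).
Context (e_conn : graph_connected e) (e_fin : locally_finite e).
Context (Gam : set (aut e)) (Gam_group : is_subgroup Gam).
Context (Gam_closed : closed Gam) (Gam_trans : acts_transitively Gam).
Context (Gam_unim : unimodular R Gam).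
Context (Q : V -> V -> R) (Q_stoch : stochastic Q) (Q_sym : symmetric_kernel Q).
Context (Q_inv : diagonally_invariant Gam Q).

Let Q_ge0 := stochastic_ge0 Q_stoch.
Let Q_sub := stochastic_sum_le Q_stoch.

Definition ball_return (k r : nat) (x : V) : R :=
  \sum_(y <- gball e x r) kernel_pow Q k x y.

Lemma kernel_pow_Gam k g x y : Gam g ->
  kernel_pow Q k x y <= kernel_pow Q k (g x) (g y).
Proof.
move=> Gg; apply: kernel_pow_inv_le => //; first exact: aut_inj.
by move=> a b; exact: Q_inv.
Qed.

(** An element of [Gam] taking [x] to [o] sends the ball about [x] into the ball about [o] and does
    not decrease the kernel. *)
Lemma ball_return_le k r x : ball_return k r x <= ball_return k r o.
Proof.
have [g Gg gx] := Gam_trans x o.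
apply: (@le_trans _ _ (\sum_(y <- gball e x r) kernel_pow Q k o (g y))).
  by apply: ler_sum => y _; rewrite -gx; exact: kernel_pow_Gam.
have -> : \sum_(y <- gball e x r) kernel_pow Q k o (g y) =
    \sum_(z <- [fset g y | y in gball e x r]%fset) kernel_pow Q k o z.
  by rewrite big_imfset//= => ? ? _ _; exact: aut_inj.
apply: sum_fset_le => [|y]; last exact: kernel_pow_ge0.
apply/fsubsetP => _ /imfsetP[y /= + ->]; rewrite !in_gball// -gx => xy.
by apply: leq_trans xy; exact: gdist_aut.
Qed.

(** The spectral profile is at most 1, so an admissible [l] satisfies l log 2 <= k. This makes the
    maximum exist. *)
Lemma admissible_bounded k r : exists n, forall l,
  admissible_exponents Gam o Q k r l -> (l <= n)%N.
Proof.
have ln2 : 0 < ln 2 :> R by rewrite ln_gt0// ltr1n.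
exists (Num.truncn (k%:R / ln 2 : R)) => l [->//|[t Ht]].
have t1 := profile_inverse_ge1 Ht.
have N1 : 1 <= 2 ^+ l.+1 * t.
  rewrite -[leLHS]mulr1; apply: ler_pM => //.
  by rewrite exprn_ege1// ler1n.
have := spectral_profile_ge0 Q_stoch Q_sym (2 ^+ l.+1 * t).
have := spectral_profile_le1 Q_stoch o N1.
case: (spectral_profile Q _) => [lam| |]//; rewrite !lee_fin => lam1 lam0.
have [->|l0] := posnP l; first by [].
have lln : 0 < l%:R * ln 2 :> R by rewrite mulr_gt0// ltr0n.
(* A zero profile makes the ratio infinite for [l] positive, so such an [l] is not admissible. *)
rewrite /inve; have [_|lam_neq0] := eqVneq lam 0.
  by rewrite gt0_muley// lte_fin.
have lamp : 0 < lam by rewrite lt_neqAle eq_sym lam_neq0.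
rewrite -EFinM lee_fin ler_pdivrMr// => H.
rewrite truncn_ge_nat; last by rewrite divr_ge0// ltW.
by rewrite ler_pdivlMr//; nra.
Qed.

(** Mass transport bounds p (1 - th) by the return rate [sg] to a nearly optimal set [A], where [th]
    is the fraction lost in crossing out of [A]. Here [th] can be taken arbitrarily close to 1/2,
    which gives the factor 2. *)
Lemma ball_return_bound k r l : (0 < r)%N -> (0 < l)%N ->
  admissible_exponents Gam o Q k r l ->
  ball_return k r o <= 2 * (2 ^- l * (3 - 2 * 2 ^- l)).
Proof.
move=> r0 l0 [l_eq0|[t Ht]]; first by rewrite l_eq0 in l0.
have t1 := profile_inverse_ge1 Ht.
have N1 : 1 <= 2 ^+ l.+1 * t.
  rewrite -[leLHS]mulr1; apply: ler_pM => //.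
  by rewrite exprn_ege1// ler1n.
have := spectral_profile_ge0 Q_stoch Q_sym (2 ^+ l.+1 * t).
have := spectral_profile_le1 Q_stoch o N1.
have := @spectral_gap_profile _ _ _ Q_stoch Q_sym (2 ^+ l.+1 * t).
case: (spectral_profile Q _) => [lam| |]// /(_ lam erefl) gap.
rewrite !lee_fin => lam1 lam0.
have lln : 0 < l%:R * ln 2 :> R by rewrite mulr_gt0 ?ltr0n// ln_gt0// ltr1n.
rewrite /inve; have [_|lam_neq0] := eqVneq lam 0.
  by rewrite gt0_muley// lte_fin.
have lamp : 0 < lam by rewrite lt_neqAle eq_sym lam_neq0.
rewrite -EFinM lee_fin ler_pdivrMr// => klam.
set p := ball_return k r o; set sg := 2 ^- l * _.
have p0 : 0 <= p by apply: sumr_ge0 => y _; exact: kernel_pow_ge0.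
have [mu [mu_haar mu_right]] := Gam_unim.
have sumA A : A != fset0 -> #|` A|%:R <= t ->
    \sum_(x <- A) \sum_(z <- A) kernel_pow Q k x z <= #|` A|%:R * sg.
  move=> A0 At.
  have -> : \sum_(x <- A) \sum_(z <- A) kernel_pow Q k x z =
    \sum_(z <- [seq (x, y) | x <- A, y <- A]) kernel_pow Q k z.1 z.2.
    by rewrite big_allpairs.
  apply: (@sum_kernel_pow_le _ _ _ _ _ _ _ A) => // W AW.
  rewrite big_allpairs /=.
  apply: (@sum_trunc_kernel_le _ _ _ _ _ _ _ _ _ lam t) => //.
  by rewrite lam0.
have pth A th : A != fset0 -> #|` A|%:R <= t ->
    (forall y, y \in gball e o r ->
      nu mu (cross Gam o y A) <= th * (#|` A|%:R * stab_mass Gam mu o)) ->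
    p * (1 - th) <= sg.
  move=> A0 At H.
  have a0 : 0 < #|` A|%:R :> R by rewrite ltr0n cardfs_gt0.
  rewrite -(ler_pM2l a0) mulrCA; apply: le_trans (sumA A A0 At).
  apply: (mass_transport_le e_fin e_conn Gam_group Gam_closed Gam_trans
    mu_haar mu_right) => //.
  - by move=> x y; exact: kernel_pow_ge0.
  - by move=> g x y Gg; exact: kernel_pow_Gam.
have crossW C A y := @nu_cross_walk _ _ _ e_fin e_conn _ Gam_group Gam_closed
  Gam_trans _ mu_haar mu_right o o y _ A C ^~ (gdistP e_conn o y).
have sg0 : 0 <= sg.
  have w0 : 0 <= (2 : R) ^- l by rewrite invr_ge0 exprn_ge0.
  have w1 : (2 : R) ^- l <= 1 by rewrite invf_le1 ?exprn_gt0// exprn_ege1// ler1n.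
  by apply: mulr_ge0 => //; lra.
have [[u [v uv]]|noe] := pselect (exists u v, e u v); last first.
  have [A [A0 At _]] := profile_inverse_approx ltr01 Ht.
  have : p * (1 - 0) <= sg.
    apply: (pth A) => // y _; have := crossW 0 A y.
    rewrite mulr0 mul0r; apply => u v uv; case: noe; by exists u, v.
  by rewrite subr0 mulr1 => /le_trans; apply; lra.
pose M := min_orbit (R := R) Gam o; pose D : R := (degree e o)%:R.
have M1 : 1 <= M by exact: (min_orbit_ge1 e_fin Gam_trans o uv).
have d0 : (0 < degree e o)%N.
  rewrite cardfs_gt0; apply/fset0Pn; have [g _ gu] := Gam_trans u o.
  by exists (g v); rewrite in_neighbours// -gu; have [_ ->] := autP g.
suff H dl : 0 < dl -> p * (1 - (2^-1 + dl)) <= sg.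
  rewrite leNgt; apply/negP => sgp.
  (* With this choice p dl <= (p / 2 - sg) / 2 < p / 2 - sg, which contradicts the bound for [dl].
     The denominator p + 1 avoids division by 0. *)
  have dl0 : 0 < (2^-1 * p - sg) / (p + 1) / 2.
    by apply: divr_gt0 => //; apply: divr_gt0; lra.
  have := H _ dl0; set dl := _ / 2 in dl0 *.
  have : dl * (p + 1) = (2^-1 * p - sg) / 2.
    by rewrite /dl mulrAC divfK// lt0r_neq0//; lra.
  nra.
move=> dl0.
(* Over at most [r] edges the error [ep] in the ratio costs the fraction r D ep / M = dl, while c /
   r itself costs 1/2. *)
pose ep := dl * M / (r%:R * D).
have rd0 : 0 < r%:R * D by rewrite mulr_gt0// ltr0n.
have M0 : 0 < M by exact: lt_le_trans M1.
have ep0 : 0 < ep by rewrite divr_gt0// mulr_gt0.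
have [A [A0 At Aratio]] := profile_inverse_approx ep0 Ht.
apply: (pth A) => // y; rewrite in_gball// => yr.
pose m := stab_mass Gam mu o; pose bA := @edge_boundary R V e A.
pose a : R := #|` A|%:R.
have bd : bA <= (M / (2 * D) / r%:R + ep) * a * D.
  by have := edge_boundary_le_ratio e_fin Gam_trans d0 A0 Aratio.
have m0 : 0 < m by exact: (stab_mass_gt0 e_fin e_conn Gam_group Gam_closed).
have C_edge x z : e x z -> nu mu (cross Gam x z A) <= bA * m / M.
  move=> xz; rewrite ler_pdivlMr// mulrC.
  apply: (nu_cross_edge e_fin e_conn) => // E HE; exact: min_orbit_le xz HE.
apply: le_trans (crossW _ _ _ C_edge) _.
have bA0 : 0 <= bA by apply: sumr_ge0.
apply: (@le_trans _ _ (r%:R * (bA * m / M))).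
  by rewrite ler_wpM2r ?ler_nat// divr_ge0 ?mulr_ge0// ltW.
rewrite -/a -/m.
have [r_neq0 D_neq0] : (r%:R : R) != 0 /\ D != 0.
  by split; rewrite pnatr_eq0 -lt0n.
have M_neq0 : M != 0 by exact: lt0r_neq0.
have rb : r%:R * bA <= (2^-1 + dl) * a * M.
  have -> : (2^-1 + dl) * a * M = r%:R * ((M / (2 * D) / r%:R + ep) * a * D).
    by rewrite /ep; field; rewrite D_neq0 r_neq0.
  by rewrite ler_wpM2l.
have -> : r%:R * (bA * m / M) = (r%:R * bA) * (m / M) by field.
have -> : (2^-1 + dl) * (a * m) = ((2^-1 + dl) * a * M) * (m / M) by field.
by rewrite ler_wpM2r// divr_ge0// ltW.
Qed.

End MainBound.

Unset Implicit Arguments.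

Theorem theorem1p8 (R : realType) (V : choiceType) (e : rel V) (o : V)
    (e_sym : symmetric e) (e_irr : irreflexive e)
    (e_conn : graph_connected e) (e_fin : locally_finite e)
    (e_trans : acts_transitively [set: aut e])
    (Gam : set (aut e)) (Gam_group : is_subgroup Gam) (Gam_closed : closed Gam)
    (Gam_trans : acts_transitively Gam) (Gam_unim : unimodular R Gam)
    (Q : V -> V -> R) (Q_stoch : stochastic Q) (Q_sym : symmetric_kernel Q)
    (Q_inv : diagonally_invariant Gam Q)
    (d : measure_display) (Om : measurableType d) (Pr : probability Om R)
    (X : nat -> Om -> V) (X_walk : random_walk Pr Q X)
    (k r : nat) (k_ge1 : (1 <= k)%N) (r_ge1 : (1 <= r)%N) :
  exists2 l : nat, is_max (admissible_exponents Gam o Q k r) l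
    & (Pr [set w | (gdist e (X 0%N w) (X k w) <= r)%N]
         <= (2 * expR (- (ln 2 / 2 * l%:R)))%:E)%E.
Proof.
have Q_ge0 := stochastic_ge0 Q_stoch.
have Q_sub := stochastic_sum_le Q_stoch.
have S0 : `[< admissible_exponents Gam o Q k r 0 >] by apply/asboolP; left.
have [n Hn] := admissible_bounded o Gam Q_stoch Q_sym k r.
have bounded l : `[< admissible_exponents Gam o Q k r l >] -> (l <= n)%N.
  by move=> /asboolP /Hn.
have [l /asboolP Sl maxl] := ex_maxnP (ex_intro _ 0%N S0) bounded.
exists l; first by split => // j Sj; apply: maxl; exact/asboolP.
(* For l <= 2 the right-hand side is 2 * 2^(-l/2) >= 1, so the bound is trivial; [decay_bound]
   covers the other values. *)
have [l2|l2] := leqP l 2.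
  apply: (@le_trans _ _ 1%E).
    by apply: probability_le1; exact: (measurable_walk_rel o e_fin e_conn X_walk 0 k
      (fun x y => (gdist e x y <= r)%N)).
  rewrite lee_fin -[leLHS](@mulfV _ (2 : R))// ler_pM2l//.
  rewrite -[in leLHS](lnK (_ : (2 : R) \is Num.pos)) ?posrE// -expRN ler_expR.
  have : (l%:R : R) <= 2 by rewrite (ler_nat R l 2).
  have : 0 < ln 2 :> R by rewrite ln_gt0// ltr1n.
  nra.
apply: (@le_trans _ _ (ball_return e Q k r o)%:E).
  apply: (walk_displacement_le o e_fin e_conn Q_ge0 Q_sub X_walk).
    by apply: sumr_ge0 => y _; exact: kernel_pow_ge0.
  exact: (ball_return_le o e_conn e_fin Gam_trans Q_stoch Q_inv).
rewrite lee_fin; apply: (@le_trans _ _ (2 * (2 ^- l * (3 - 2 * 2 ^- l)))).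
  apply: (ball_return_bound e_conn e_fin Gam_group Gam_closed Gam_trans Gam_unim
    Q_stoch Q_sym Q_inv r_ge1 _ Sl).
  exact: ltn_trans l2.
by rewrite ler_pM2l//; exact: decay_bound.
Qed.
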